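(* Let $R$ be an $h$-local domain with at least two different maximal ideals $\mathfrak m_1,\mathfrak m_2$. For $i=1,2$, let $M_i$ be a finitely generated, indecomposable, torsion-free $R_{\mathfrak m_i}$-module with local endomorphism ring and rank $r_i$. Then: (1) for $i=1,2$ there exists a finitely generated, indecomposable, torsion-free $R$-module $X_i$ such that $(X_i)_{\mathfrak m_i}\cong M_i$ and $(X_i)_{\mathfrak m}\cong R_\mathfrak m^{r_i}$ for every maximal ideal $\mathfrak m\neq \mathfrak m_i$; (2) if $r_1$ and $r_2$ are not coprime, then $\mathrm{Add}(X_1\oplus X_2)$ contains modules that are not direct sums of finitely generated modules.
   Context: A commutative domain is $h$-local if every non-zero element lies in only finitely many maximal ideals and every non-zero prime ideal is contained in a unique maximal ideal. A module $M$ over a domain with field of fractions $Q$ is torsion-free if $M\to M\otimes_R Q$ is injective; its rank is $\dim_Q(M\otimes_RQ)$. $\mathrm{Add}(M)$ is the class of modules isomorphic to direct summands of direct sums of copies of $M$. *)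

(* Defs.v *)
From HB Require Import structures.
From mathcomp Require Import all_boot all_order all_algebra.
From mathcomp Require Import boolp.
From Stdlib Require List.

Set Implicit Arguments.
Unset Strict Implicit.
Unset Printing Implicit Defensive.

Import GRing.Theory.
Local Open Scope ring_scope.
Local Notation "x %:F" := (@FracField.tofrac _ x).

Section Ideals.
Variable R : comNzRingType.

Definition is_ideal (J : R -> Prop) : Prop :=
  [/\ J 0, (forall x y, J x -> J y -> J (x + y)) & (forall a x, J x -> J (a * x))].

Definition same_ideal (I J : R -> Prop) : Prop := forall x, I x <-> J x.

Definition is_maximal_ideal (m : R -> Prop) : Prop :=
  [/\ is_ideal m, ~ m 1 &
      forall J, is_ideal J -> (forall x, m x -> J x) -> ~ J 1 -> forall x, J x -> m x].

Definition is_prime_ideal (P : R -> Prop) : Prop :=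
  [/\ is_ideal P, ~ P 1 & forall a b, P (a * b) -> P a \/ P b].

Definition h_local : Prop :=
  (forall r : R, r != 0 ->
     exists l : seq (R -> Prop), forall m, is_maximal_ideal m -> m r ->
       exists2 m', List.In m' l & same_ideal m m') /\
  (forall P, is_prime_ideal P -> (exists x, x != 0 /\ P x) ->
     exists m, [/\ is_maximal_ideal m, (forall x, P x -> m x) &
       forall m', is_maximal_ideal m' -> (forall x, P x -> m' x) -> same_ideal m m']).
End Ideals.

(* Denominators: finite products of non-zero elements outside m (for a  *)
(* maximal -- hence prime -- ideal m this is exactly R \ m).            *)

Section Localization.
Variables (R : idomainType) (m : R -> Prop).

Definition loc_den (s : R) : Prop :=
  exists l : seq R, (forall x, List.In x l -> x != 0 /\ ~ m x) /\ s = \prod_(x <- l) x.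

Lemma loc_den_neq0 s : loc_den s -> s != 0.
Proof.
move=> [l [Hl ->]]; elim: l Hl => [|a l IH] Hl; first by rewrite big_nil oner_neq0.
rewrite big_cons mulf_neq0 //; first by case: (Hl a) => //; left.
by apply: IH => x Hx; apply: Hl; right.
Qed.

Lemma loc_den1 : loc_den 1.
Proof. by exists [::]; split => //; rewrite big_nil. Qed.

Lemma loc_denM s t : loc_den s -> loc_den t -> loc_den (s * t).
Proof.
move=> [l1 [H1 ->]] [l2 [H2 ->]]; exists (l1 ++ l2); split; last by rewrite big_cat.
move=> x Hx; case: (List.in_app_or _ _ _ Hx) => ?; [exact: H1 | exact: H2].
Qed.

Definition locP : {pred {fraction R}} :=
  fun q => `[< exists a s, loc_den s /\ q = a%:F / s%:F >].

Lemma locP_subring : subring_closed locP.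
Proof.
have nz s : loc_den s -> s%:F != 0 :> {fraction R}.
  by move=> /loc_den_neq0; rewrite tofrac_eq0.
split.
- by apply/asboolP; exists 1, 1; split; [exact: loc_den1 | rewrite invr1 mulr1].
- move=> u v /asboolP [a [s [Hs ->]]] /asboolP [b [t [Ht ->]]].
  apply/asboolP; exists (a * t - b * s), (s * t); split; first exact: loc_denM.
  have := nz _ Hs; have := nz _ Ht => Ht0 Hs0.
  rewrite tofracB !tofracM invfM mulrBl; congr (_ - _).
    by rewrite mulrACA divff // mulr1.
  by rewrite [_^-1 * _^-1]mulrC mulrACA divff // mulr1.
- move=> u v /asboolP [a [s [Hs ->]]] /asboolP [b [t [Ht ->]]].
  apply/asboolP; exists (a * b), (s * t); split; first exact: loc_denM.
  have := nz _ Hs; have := nz _ Ht => Ht0 Hs0.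
  by rewrite !tofracM invfM mulrACA.
Qed.

HB.instance Definition _ := GRing.isSubringClosed.Build _ locP locP_subring.

Record Loc := MkLoc { locval : {fraction R}; locvalP : locval \in locP }.

HB.instance Definition _ := [isSub for locval].
HB.instance Definition _ := [Choice of Loc by <:].
HB.instance Definition _ := [SubChoice_isSubComNzRing of Loc by <:].

Lemma toLoc_subproof (r : R) : r%:F \in locP.
Proof. by apply/asboolP; exists r, 1; split; [exact: loc_den1 | rewrite tofrac1 invr1 mulr1]. Qed.

Definition toLoc (r : R) : Loc := MkLoc (toLoc_subproof r).
End Localization.

Section Modules.
Variable A : comNzRingType.

Definition fin_gen (M : lmodType A) : Prop :=
  exists n (g : 'I_n -> M), forall x, exists c : 'I_n -> A, x = \sum_i c i *: g i.

Definition is_submod (M : lmodType A) (P : M -> Prop) : Prop :=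
  [/\ P 0, (forall x y, P x -> P y -> P (x + y)) & (forall a x, P x -> P (a *: x))].

Definition indecomposable (M : lmodType A) : Prop :=
  (exists x : M, x != 0) /\
  forall P1 P2 : M -> Prop, is_submod P1 -> is_submod P2 ->
    (forall x, P1 x -> P2 x -> x = 0) ->
    (forall x, exists y z, [/\ P1 y, P2 z & x = y + z]) ->
    (forall x, P1 x -> x = 0) \/ (forall x, P2 x -> x = 0).

(* torsion-free over a domain: M -> M (x) Q is injective, i.e. the kernel
   {x | s x = 0 for some s <> 0} of the localization map is trivial *)
Definition torsion_free (M : lmodType A) : Prop :=
  forall (a : A) (x : M), a != 0 -> a *: x = 0 -> x = 0.

Definition is_linear_map (M N : lmodType A) (f : M -> N) : Prop :=
  (forall x y, f (x + y) = f x + f y) /\ (forall a x, f (a *: x) = a *: f x).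

Definition local_end (M : lmodType A) : Prop :=
  (exists x : M, x != 0) /\
  forall f : M -> M, is_linear_map f -> bijective f \/ bijective (fun x => x - f x).

(* phi : X -> Y exhibits the B-module Y as the localization S^{-1} X, where
   iota : A -> B is the localization map of rings (B = S^{-1} A):
   phi is iota-semilinear and the induced map S^{-1}X -> Y, x/s |-> phi x / s,
   is bijective. *)
Definition is_localization (B : comNzRingType) (iota : A -> B) (S : A -> Prop)
  (X : lmodType A) (Y : lmodType B) (phi : X -> Y) : Prop :=
  [/\ (forall x y, phi (x + y) = phi x + phi y),
      (forall a x, phi (a *: x) = iota a *: phi x),
      (forall y, exists x s, S s /\ iota s *: y = phi x) &
      (forall x, phi x = 0 -> exists s, S s /\ s *: x = 0)].

(* rank: dim_Q (M (x)_A Q) = r, where iota : A -> Q is the inclusion of A in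
   its field of fractions Q; i.e. M (x) Q = (A\0)^{-1} M is isomorphic to Q^r *)
Definition has_rank (Q : fieldType) (iota : A -> Q) (M : lmodType A) (r : nat) : Prop :=
  exists phi : M -> 'rV[Q]_r, is_localization iota (fun a => a != 0) phi.

Definition fin_supp (I : Type) (X : lmodType A) (f : I -> X) : Prop :=
  exists l : seq I, forall i, ~ List.In i l -> f i = 0.

(* N \in Add(X): N is isomorphic to a direct summand of X^(I) for some index
   set I (X^(I) = finitely supported families I -> X): there are linear maps
   iota : N -> X^(I) and pi : X^(I) -> N with pi \o iota = id. *)
Definition in_Add (X N : lmodType A) : Prop :=
  exists (I : Type) (iota : N -> I -> X) (pi : (I -> X) -> N),
  [/\ (forall x, fin_supp (iota x)) /\
      (forall x y i, iota (x + y) i = iota x i + iota y i),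
      (forall a x i, iota (a *: x) i = a *: iota x i),
      (forall f g, fin_supp f -> fin_supp g -> pi (fun i => f i + g i) = pi f + pi g),
      (forall a f, fin_supp f -> pi (fun i => a *: f i) = a *: pi f) &
      (forall x, pi (iota x) = x)].

Definition fg_submod (N : lmodType A) (P : N -> Prop) : Prop :=
  exists n (g : 'I_n -> N), (forall i, P (g i)) /\
    forall x, P x -> exists c : 'I_n -> A, x = \sum_i c i *: g i.

Definition dsum_of_fg (N : lmodType A) : Prop :=
  exists (J : Type) (P : J -> N -> Prop),
  [/\ (forall j, is_submod (P j) /\ fg_submod (P j)),
      (forall x, exists (l : seq J) (y : J -> N), (forall j, P j (y j)) /\ x = \sum_(j <- l) y j) &
      (forall (l : seq J) (y : J -> N), List.NoDup l -> (forall j, P j (y j)) ->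
          \sum_(j <- l) y j = 0 -> forall j, List.In j l -> y j = 0)].
End Modules.

Definition genus_cond (R : idomainType) (m : R -> Prop) (M : lmodType (Loc m))
    (r : nat) (X : lmodType R) : Prop :=
  [/\ fin_gen X, indecomposable X, torsion_free X,
      (exists phi : X -> M, is_localization (@toLoc R m) (fun s => ~ m s) phi) &
      (forall m' : R -> Prop, is_maximal_ideal m' -> ~ same_ideal m' m ->
         exists phi : X -> 'rV[Loc m']_r,
           is_localization (@toLoc R m') (fun s => ~ m' s) phi)].

(* Main.v *)
Require Import Defs.
From HB Require Import structures.
From mathcomp Require Import all_boot all_order all_algebra.
From mathcomp Require Import boolp ring zify.
From mathcomp Require classical_sets.
From Stdlib Require List.

(* Write F for the fraction field. Over an h-local domain, a non-zero sigma can be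
   split by maximal ideals: for m <> m' there are t outside m and u outside m' with
   t u in sigma R, for otherwise some non-zero prime would lie in both m and m'.
   Realizing M between sigma R_m^r and R_m^r inside F^r, generators of M in R^r
   together with the vectors u delta_i span a finitely generated X with X_m = M and
   X_m' = R_m'^r for all other m'.

   Inside R^(nat) put N = X_1^(nat) /\ (R (+) X_2^(nat)). If j1 + j2 = 1 with
   j_i R^(r_i) in X_i, then (y, z) |-> j2 y + j1 z retracts the diagonal
   N -> X_1^(nat) (+) (R (+) X_2^(nat)), and R is a summand of X_1 (+) X_2, so N lies
   in Add(X_1 (+) X_2). A projection of N onto a finitely generated summand is an
   idempotent matrix E over F of finite rank. At m_1 it preserves powers of M_1, so
   r_1 divides the rank of E. If N were a direct sum of finitely generated modules,
   some E would have a unit of R_m2 in position (0, 0); splitting it off by a Schur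
   complement leaves an idempotent preserving powers of M_2, so r_2 divides the rank
   of E minus 1, and r_1, r_2 are coprime. *)

Set Implicit Arguments.
Unset Strict Implicit.
Unset Printing Implicit Defensive.

Import GRing.Theory.
Local Open Scope ring_scope.

(** * Submodules as modules in their own right *)

Section SubLmod.
Variables (A : comNzRingType) (V : lmodType A) (P : V -> Prop).
Hypothesis Psub : is_submod P.

(** The closure proof is an argument so that the submodule structure can be inferred from the
    predicate. *)
Definition submod_pred of is_submod P : {pred V} := fun x => `[< P x >].

Lemma submod_pred_closed : submod_closed (submod_pred Psub).
Proof.
case: Psub => P0 PD PZ; split; first exact/asboolP.
by move=> a u v /asboolP Pu /asboolP Pv; apply/asboolP/PD => //; apply: PZ.
Qed.

HB.instance Definition _ :=
  GRing.isSubmodClosed.Build A V (submod_pred Psub) submod_pred_closed.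

Record submod := Submod { submod_val : V; _ : submod_val \in submod_pred Psub }.

HB.instance Definition _ := [isSub for submod_val].
HB.instance Definition _ := [Choice of submod by <:].
HB.instance Definition _ := [SubChoice_isSubLmodule of submod by <:].

Lemma submodP (x : submod) : P (val x).
Proof. by case: x => x Px; apply/asboolP. Qed.

Definition mk_submod x (Px : P x) : submod := Submod (introT (asboolP _) Px).

Lemma submod_valD (x y : submod) : val (x + y) = val x + val y.
Proof. exact: raddfD. Qed.

Lemma submod_valZ a (x : submod) : val (a *: x) = a *: val x.
Proof. exact: linearZ. Qed.

Lemma submod_val0 : val (0 : submod) = 0.
Proof. exact: raddf0. Qed.

Lemma submod_val_sum (I : Type) (l : seq I) (D : pred I) (f : I -> submod) :
  val (\sum_(i <- l | D i) f i) = \sum_(i <- l | D i) val (f i).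
Proof. exact: raddf_sum. Qed.
End SubLmod.



(** * Ideals and h-local domains *)

Section Ideals.
Variable R : comNzRingType.
Implicit Types m P : R -> Prop.

Lemma ideal_adjoin (P : R -> Prop) a :
  is_ideal P -> is_ideal (fun x => exists p b, P p /\ x = p + b * a).
Proof.
case=> P0 PD PM; split.
- by exists 0, 0; rewrite mul0r addr0.
- move=> _ _ [p [b [Pp ->]]] [q [c [Pq ->]]]; exists (p + q), (b + c).
  by split; [exact: PD | rewrite mulrDl addrACA].
- move=> c _ [p [b [Pp ->]]]; exists (c * p), (c * b).
  by split; [exact: PM | rewrite mulrDr mulrA].
Qed.

Lemma maximal_comax m a : is_maximal_ideal m -> ~ m a -> exists b, m (1 - b * a).
Proof.
case=> mI _ mmax ma; pose J x := exists p b, m p /\ x = p + b * a.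
have [m0 _ _] := mI.
have [[p [b [mp e1]]]|J1] := pselect (J 1).
  by exists b; rewrite e1 addrK.
case: ma; apply: (mmax J) => //; first exact: ideal_adjoin.
  by move=> x mx; exists x, 0; rewrite mul0r addr0.
by exists 0, 1; rewrite mul1r add0r.
Qed.

Lemma maximal_prime m : is_maximal_ideal m -> is_prime_ideal m.
Proof.
move=> mM; have [mI m1 _] := mM; have [m0 mD mMl] := mI; split=> // a b mab.
have [?|/(maximal_comax mM) [c mc]] := pselect (m a); [by left | right].
have -> : b = b * (1 - c * a) + c * (a * b).
  by ring.
by apply: mD; apply: mMl.
Qed.

Lemma maximal_mulN m a b : is_maximal_ideal m -> ~ m a -> ~ m b -> ~ m (a * b).
Proof. by move=> /maximal_prime [_ _ mP] ma mb /mP []. Qed.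

Lemma maximal_neq0 m a : is_maximal_ideal m -> ~ m a -> a != 0.
Proof. by case=> [[m0 _ _] _ _] ma; apply/eqP=> a0; apply: ma; rewrite a0. Qed.

(** Zorn's lemma, then Krull's argument: an ideal maximal among those containing [I] and missing [S]
    is prime. Maximality stays in the conclusion because [S] = {1} then yields maximal ideals. *)
Lemma ideal_avoiding (S I : R -> Prop) :
  S 1 -> (forall a b, S a -> S b -> S (a * b)) ->
  is_ideal I -> (forall a, I a -> ~ S a) ->
  exists P, [/\ is_prime_ideal P, forall a, I a -> P a, forall a, P a -> ~ S a &
    forall J, is_ideal J -> (forall a, P a -> J a) -> (forall a, J a -> ~ S a) ->
      forall a, J a -> P a].
Proof.
move=> S1 SM Iid IS; have [I0 _ _] := Iid.
pose good (A : R -> Prop) :=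
  [/\ is_ideal A, forall a, I a -> A a & forall a, A a -> ~ S a].
(* [Zorn_bigcup] also applies to the empty chain, so the empty set must satisfy [Q]. *)
pose Q (A : R -> Prop) := (forall x, ~ A x) \/ good A.
have [C CQ Ctot|A [QA Amax]] := @classical_sets.Zorn_bigcup R Q.
  have [[x [B CB Bx]]|none] := pselect (exists x, classical_sets.bigcup C id x); last first.
    by left=> x Cx; apply: none; exists x.
  right.
  have gd B' y : C B' -> B' y -> good B'.
    by move=> CB' B'y; case: (CQ _ CB') => // /(_ y).
  have [[B0 _ _] IB _] := gd _ _ CB Bx.
  split; last by move=> a [B' CB' B'a]; have [_ _ ] := gd _ _ CB' B'a; apply.
    split; first by exists B.
      move=> u v [B1 CB1 B1u] [B2 CB2 B2v].
      case: (Ctot _ _ CB1 CB2) => sub.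
        exists B2 => //; have [[_ BD _] _ _] := gd _ _ CB2 B2v.
        by apply: BD => //; apply: sub.
      exists B1 => //; have [[_ BD _] _ _] := gd _ _ CB1 B1u.
      by apply: BD => //; apply: sub.
    move=> a u [B1 CB1 B1u]; exists B1 => //.
    by have [[_ _ BM] _ _] := gd _ _ CB1 B1u; apply: BM.
  by move=> a Ia; exists B => //; apply: IB.
case: QA => [A0|gA].
  by case: (Amax I); [split=> [x /A0 //|/(_ 0 I0) /A0] | right].
have [AI IA AS] := gA; have [Aid0 AD AM] := AI.
have maxA J : is_ideal J -> (forall a, A a -> J a) -> (forall a, J a -> ~ S a) ->
    forall a, J a -> A a.
  move=> Jid AJ JS a Ja; apply: contrapT => nAa; case: (Amax J).
    by split=> // sub; apply: nAa; apply: sub.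
  by right; split=> // b /IA /AJ.
have meets a : ~ A a -> exists b p, A p /\ S (p + b * a).
  move=> nAa; pose B x := exists p b, A p /\ x = p + b * a.
  have [//|none] := pselect (exists b p, A p /\ S (p + b * a)).
  case: nAa; apply: (maxA B); first exact: ideal_adjoin.
  - by move=> x Ax; exists x, 0; rewrite mul0r addr0.
  - by move=> _ [p [b [Ap ->]]] Spb; apply: none; exists b, p.
  - by exists 0, 1; rewrite mul1r add0r.
exists A; split=> //; split=> // [A1|a b Aab]; first exact: (AS 1).
have [?|/meets [c [p [Ap Sa]]]] := pselect (A a); [by left|].
have [?|/meets [d [q [Aq Sb]]]] := pselect (A b); [by right|].
(* The elements of [S] found in A + Ra and A + Rb have their product in A, since ab is in A. *)
case: (AS _ _ (SM _ _ Sa Sb)).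
have -> : (p + c * a) * (q + d * b) = (q + d * b) * p + (c * a) * q + (c * d) * (a * b).
  by ring.
by apply: (AD); [apply: AD|]; apply: AM.
Qed.

Lemma proper_sub_maximal (I : R -> Prop) : is_ideal I -> ~ I 1 ->
  exists m, is_maximal_ideal m /\ forall a, I a -> m a.
Proof.
move=> Iid I1.
have [||a Ia ea|m [[mid m1 _] Im _ mmax]] := @ideal_avoiding (fun a => a = 1) I _ _ Iid => //.
- by move=> _ _ -> ->; rewrite mul1r.
- by apply: I1; rewrite -ea.
exists m; split=> //; split=> // J Jid mJ J1 x; apply: mmax => // a Ja ea.
by apply: J1; rewrite -ea.
Qed.

Lemma ideals_comax (I J : R -> Prop) : is_ideal I -> is_ideal J ->
  (forall m, is_maximal_ideal m -> exists a, (I a \/ J a) /\ ~ m a) ->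
  exists a b, [/\ I a, J b & a + b = 1].
Proof.
move=> [I0 ID IM] [J0 JD JM] h.
pose K x := exists a b, [/\ I a, J b & a + b = x].
have Kid : is_ideal K.
  split; first by exists 0, 0; rewrite addr0.
    move=> _ _ [a [b [Ia Jb <-]]] [c [d [Ic Jd <-]]]; exists (a + c), (b + d).
    by split; [exact: ID | exact: JD | rewrite addrACA].
  move=> c _ [a [b [Ia Jb <-]]]; exists (c * a), (c * b).
  by split; [exact: IM | exact: JM | rewrite mulrDr].
have [//|/(proper_sub_maximal Kid) [m [mM Km]]] := pselect (K 1).
have [a [IJa ma]] := h m mM; case: ma; apply: Km.
by case: IJa => ?; [exists a, 0; rewrite addr0 | exists 0, a; rewrite add0r].
Qed.

(** Otherwise the ideal generated by [sigma] misses the multiplicative set of products t u; a prime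
    containing [sigma] and missing this set lies in both [m] and [m'], against h-locality. *)
Lemma h_local_separate m m' sigma : h_local R ->
  is_maximal_ideal m -> is_maximal_ideal m' -> ~ same_ideal m' m -> sigma != 0 ->
  exists t u a, [/\ ~ m t, ~ m' u & t * u = a * sigma].
Proof.
move=> [_ hl] mM m'M neq sn0; apply: contrapT => none.
pose S x := exists t u, [/\ ~ m t, ~ m' u & x = t * u].
have m1 : ~ m 1 by case: mM. have m'1 : ~ m' 1 by case: m'M.
pose I x := exists a, x = a * sigma.
have Iid : is_ideal I.
  split; first by exists 0; rewrite mul0r.
    by move=> _ _ [b ->] [c ->]; exists (b + c); rewrite mulrDl.
  by move=> a _ [b ->]; exists (a * b); rewrite mulrA.
have [||_ [a ->] [t [u [mt mu e]]]|P [Pp IP PS _]] := @ideal_avoiding S I _ _ Iid.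
- by exists 1, 1; rewrite mulr1.
- move=> _ _ [t [u [mt mu ->]]] [v [w [mv mw ->]]].
  by exists (t * v), (u * w); split; [exact: maximal_mulN | exact: maximal_mulN | rewrite mulrACA].
- by apply: none; exists t, u, a.
have Ps : P sigma by apply: IP; exists 1; rewrite mul1r.
have [|m0 [_ _ uniq]] := hl P Pp; first by exists sigma.
have Pm x : P x -> m x.
  move=> Px; apply: contrapT => nm; apply: (PS _ Px).
  by exists x, 1; rewrite mulr1.
have Pm' x : P x -> m' x.
  move=> Px; apply: contrapT => nm; apply: (PS _ Px).
  by exists 1, x; rewrite mul1r.
have e1 := uniq _ mM Pm; have e2 := uniq _ m'M Pm'.
by apply: neq => x; split=> [/e2/e1 | /e1/e2].
Qed.

(** Only finitely many maximal ideals contain [sigma]: each of them other than [m] gets a separating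
    multiplier, and [sigma] itself serves all the rest. At [m] every multiplier falls into sigma
    R_m; at any other maximal ideal some multiplier is a unit. *)
Lemma h_local_multipliers m sigma : h_local R -> is_maximal_ideal m -> sigma != 0 ->
  exists us : seq R,
    (forall u, u \in us -> exists t a, ~ m t /\ t * u = a * sigma) /\
    (forall m', is_maximal_ideal m' -> ~ same_ideal m' m -> exists2 u, u \in us & ~ m' u).
Proof.
move=> hl mM sn0; have [l Hl] := hl.1 _ sn0.
have {Hl} Hl m' : is_maximal_ideal m' -> m' sigma ->
  exists2 n, List.In n l & same_ideal m' n by exact: Hl.
suff [us [us1 us2]] : exists us : seq R,
    (forall u, u \in us -> exists t a, ~ m t /\ t * u = a * sigma) /\
    (forall n, List.In n l -> forall m', same_ideal m' n -> is_maximal_ideal m' ->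
        ~ same_ideal m' m -> exists2 u, u \in us & ~ m' u).
  exists (sigma :: us); split=> [u|m' m'M neq].
    rewrite inE => /orP [/eqP ->|/us1 //].
    by exists 1, 1; split => //; case: mM.
  have [ms|] := pselect (m' sigma); last by exists sigma => //; exact: mem_head.
  have [n ln e] := Hl _ m'M ms.
  by have [u uus mu] := us2 n ln _ e m'M neq; exists u => //; rewrite inE uus orbT.
elim: l {Hl} => [|n l [us [us1 us2]]]; first by exists [::].
(* The list may contain [m] itself or predicates that are not maximal ideals; such entries
   contribute no multiplier. *)
have [[m' [e m'M neq]]|none] := pselect (exists m', [/\ same_ideal m' n,
    is_maximal_ideal m' & ~ same_ideal m' m]); last first.
  exists us; split=> // k /= [<-|/us2 //] m' e m'M neq.
  by case: none; exists m'.
have [t [u [a [mt mu etu]]]] := h_local_separate hl mM m'M neq sn0.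
exists (u :: us); split=> [v|].
  by rewrite inE => /orP [/eqP ->|/us1 //]; exists t, a.
move=> k /= [<-|lk] m2 e2 m2M neq2.
  by exists u; [exact: mem_head | move/e2/e].
by have [v vus mv] := us2 k lk _ e2 m2M neq2; exists v => //; rewrite inE vus orbT.
Qed.
End Ideals.

(** * Schur complements of block matrices *)

Section Schur.
Variables (F : fieldType) (p q : nat).
Implicit Type E : 'M[F]_(p + q).

Definition schur E : 'M[F]_q :=
  drsubmx E - dlsubmx E *m invmx (ulsubmx E) *m ursubmx E.

(** Block elimination: with a the invertible upper left block, E is a lower unitriangular matrix
    times diag(a, [schur E]) times an upper unitriangular one. *)
Lemma schur_rank E : ulsubmx E \in unitmx -> \rank E = (p + \rank (schur E))%N.
Proof.
move=> ua; set a := ulsubmx E in ua *; set b := ursubmx E; set c := dlsubmx E.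
pose L : 'M[F]_(p + q) := block_mx 1%:M 0 (c *m invmx a) 1%:M.
pose U : 'M[F]_(p + q) := block_mx 1%:M (invmx a *m b) 0 1%:M.
have uL : L \in unitmx by rewrite unitmxE det_lblock !det1 mulr1 unitr1.
have uU : U \in unitmx by rewrite unitmxE det_ublock !det1 mulr1 unitr1.
have {1}-> : E = L *m block_mx a 0 0 (schur E) *m U.
  rewrite /schur -/a -/b -/c !mulmx_block
     !(mul1mx, mul0mx, mulmx1, mulmx0, addr0, add0r) !mulmxA mulmxV // mul1mx.
  by rewrite mulmxKV // addrC subrK submxK.
rewrite mxrankMfree ?row_free_unit // -mxrank_tr trmx_mul mxrankMfree ?row_free_unit ?unitmx_tr //.
by rewrite mxrank_tr rank_diag_block_mx mxrank_unit.
Qed.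

(** Let E have blocks a, b, c, d and put w = c a^-1 b. The block equations of E E = E give d d = d -
    c b and d w = w d = w w = w - c b, whence d - w is idempotent. *)
Lemma schur_idem E : ulsubmx E \in unitmx -> E *m E = E ->
  schur E *m schur E = schur E.
Proof.
move=> ua; rewrite -[E in E *m E]submxK -[E in _ = E]submxK mulmx_block /schur.
set a := ulsubmx E in ua *; set b := ursubmx E; set c := dlsubmx E; set d := drsubmx E.
case/eq_block_mx => ea eb ec ed.
have db : b *m d = b - a *m b by rewrite -[X in X - _]eb addrC addKr.
have dc : d *m c = c - c *m a by rewrite -[X in X - _]ec addrC addKr.
have bc : b *m c = a - a *m a by rewrite -[X in X - _]ea addrC addKr.
have dd : d *m d = d - c *m b by rewrite -[X in X - _]ed addrC addKr.
set w := c *m invmx a *m b.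
have dw : d *m w = w - c *m b.
  by rewrite /w !mulmxA dc mulmxBl mulmxK // mulmxBl.
have wd : w *m d = w - c *m b.
  by rewrite /w -!mulmxA db !mulmxBr [invmx a *m (a *m b)]mulmxA mulVmx // mul1mx.
have ww : w *m w = w - c *m b.
  rewrite {1}/w /w -!mulmxA [b *m (c *m _)]mulmxA bc mulmxBl -!mulmxA.
  rewrite [a *m (invmx a *m b)]mulmxA mulmxV // mul1mx !mulmxBr.
  by rewrite [invmx a *m (a *m b)]mulmxA mulVmx // mul1mx.
by rewrite mulmxBl !mulmxBr dd dw wd ww subrr subr0 opprB addrA subrK.
Qed.
End Schur.

(** * Idempotent matrices preserving powers of a lattice *)

Section Preserving.
Variable F : fieldType.

Definition subgroup n (L : 'rV[F]_n -> Prop) :=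
  L 0 /\ forall u v, L u -> L v -> L (u - v).

Definition preserves n (L : 'rV[F]_n -> Prop) (E : 'M_n) :=
  forall v, L v -> L (v *m E).

Definition prodL p q (L1 : 'rV[F]_p -> Prop) (L2 : 'rV[F]_q -> Prop) (v : 'rV_(p + q)) :=
  L1 (lsubmx v) /\ L2 (rsubmx v).

(** Factors are peeled off one at a time: [k.+1 * r] is convertible to [r + k * r], so block
    operations apply without casts. *)
Fixpoint powL r (L : 'rV[F]_r -> Prop) k : 'rV[F]_(k * r) -> Prop :=
  if k is k'.+1 then prodL L (@powL r L k') else fun=> True.

(** Matrix counterpart of [local_end]: the ring of matrices preserving [L] is local. *)
Definition local_stabilizer n (L : 'rV[F]_n -> Prop) := forall A, preserves L A ->
  (A \in unitmx /\ preserves L (invmx A)) \/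
  (1%:M - A \in unitmx /\ preserves L (invmx (1%:M - A))).

Lemma subgroup_prodL p q (L1 : 'rV[F]_p -> Prop) (L2 : 'rV[F]_q -> Prop) :
  subgroup L1 -> subgroup L2 -> subgroup (prodL L1 L2).
Proof.
move=> [L10 L1B] [L20 L2B]; split; first by split; rewrite linear0.
by move=> u v [u1 u2] [v1 v2]; split; rewrite linearB; [apply: L1B | apply: L2B].
Qed.

Lemma subgroup_powL r (L : 'rV[F]_r -> Prop) k : subgroup L -> subgroup (@powL r L k).
Proof. by move=> sL; elim: k => [|k IH] //; apply: subgroup_prodL. Qed.

Lemma preservesB n (L : 'rV[F]_n -> Prop) A B : subgroup L ->
  preserves L A -> preserves L B -> preserves L (A - B).
Proof. by move=> [_ LB] pA pB v Lv; rewrite mulmxBr; apply: LB; [apply: pA | apply: pB]. Qed.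

Lemma preserves1 n (L : 'rV[F]_n -> Prop) : preserves L 1%:M.
Proof. by move=> v; rewrite mulmx1. Qed.

Section Blocks.
Variables (p q : nat) (L1 : 'rV[F]_p -> Prop) (L2 : 'rV[F]_q -> Prop).
Hypotheses (sL1 : subgroup L1) (sL2 : subgroup L2).
Variable E : 'M[F]_(p + q).
Hypothesis pE : preserves (prodL L1 L2) E.

Let pE_row u w : L1 u -> L2 w ->
  L1 (u *m ulsubmx E + w *m dlsubmx E) /\ L2 (u *m ursubmx E + w *m drsubmx E).
Proof.
move=> Lu Lw; have /pE : prodL L1 L2 (row_mx u w) by split; rewrite ?row_mxKl ?row_mxKr.
by rewrite -{1}[E]submxK mul_row_block /prodL row_mxKl row_mxKr.
Qed.

Lemma preserves_ulsubmx : preserves L1 (ulsubmx E).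
Proof. by move=> u Lu; have [] := pE_row Lu sL2.1; rewrite !mul0mx !addr0. Qed.

(** With blocks a, b, c, d of E and w in [L2]: (0, w) E has components w c and w d. Then w c a^-1 is
    in [L1], so (w c a^-1, 0) E puts w c a^-1 b in [L2], and this is subtracted from w d. *)
Lemma preserves_schur : preserves L1 (invmx (ulsubmx E)) -> preserves L2 (schur E).
Proof.
move=> pV w Lw; have [L1w L2w] := pE_row sL1.1 Lw; rewrite !mul0mx !add0r in L1w L2w.
have [_ ] := pE_row (pV _ L1w) sL2.1; rewrite mul0mx addr0 => Lc.
by rewrite /schur mulmxBr !mulmxA; apply: sL2.2.
Qed.
End Blocks.

(** Induction on [k]. By locality the upper left block of E or of 1 - E is a unit of the stabilizer,
    and a Schur complement splits off rank [r]. In the second case divisibility passes back to E,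
    because the ranks of E and 1 - E add up to a multiple of [r]. *)
Lemma local_idempotent_rank r (L : 'rV[F]_r -> Prop) k (E : 'M[F]_(k * r)) :
  subgroup L -> local_stabilizer L -> preserves (@powL r L k) E -> E *m E = E ->
  (r %| \rank E)%N.
Proof.
move=> sL lL; elim: k E => [|k IH] E pE iE.
  by have := rank_leq_row E; rewrite leqn0 => /eqP ->.
have step (G : 'M[F]_(r + k * r)) : preserves (prodL L (@powL r L k)) G -> G *m G = G ->
    ulsubmx G \in unitmx -> preserves L (invmx (ulsubmx G)) -> (r %| \rank G)%N.
  move=> pG iG uG pV; rewrite schur_rank // dvdn_addr //; apply: IH.
    exact: (preserves_schur sL (subgroup_powL k sL) pG).
  exact: schur_idem.
pose G : 'M[F]_(r + k * r) := E.
have iG : G *m G = G by exact: iE.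
have pG : preserves (prodL L (@powL r L k)) G by exact: pE.
have sP := subgroup_prodL sL (subgroup_powL k sL).
have pG' : preserves (prodL L (@powL r L k)) (1%:M - G).
  by apply: preservesB => //; exact: preserves1.
have iG' : (1%:M - G) *m (1%:M - G) = 1%:M - G.
  by rewrite mulmxBl mul1mx mulmxBr mulmx1 iG subrr subr0.
have := lL _ (preserves_ulsubmx (subgroup_powL k sL) pG).
have -> : 1%:M - ulsubmx G = ulsubmx (1%:M - G).
  by apply/matrixP=> i j; rewrite !mxE (inj_eq (@lshift_inj _ _)).
case=> [] [uG pV]; first exact: (step G).
have rG : (\rank G + \rank (1%:M - G)%R = r + k * r)%N.
  have G0 : G *m (1%:M - G) = 0 by rewrite mulmxBr mulmx1 iG subrr.
  apply/eqP; rewrite eqn_leq; apply/andP; split.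
    by have := mulmx0_rank_max G0.
  rewrite -{1}(@mxrank1 F (r + k * r)).
  have {1}-> : 1%:M = G + (1%:M - G) by rewrite addrC subrK.
  exact: mxrank_add.
have d1 := step _ pG' iG' uG pV.
by rewrite -(dvdn_addl _ d1) rG -mulSn dvdn_mull.
Qed.
End Preserving.

(** * Realizing a module over a localization *)

Local Notation "x %:F" := (@FracField.tofrac _ x).

(** Serves to clear denominators in finite families: the product of the individual multipliers works
    for all indices. *)
Lemma common_multiplier (R : comNzRingType) (S : R -> Prop) (I : finType)
    (P : I -> R -> Prop) :
  S 1 -> (forall a b, S a -> S b -> S (a * b)) ->
  (forall i a s, P i s -> P i (a * s)) ->
  (forall i, exists2 s, S s & P i s) -> exists2 s, S s & forall i, P i s.
Proof.
move=> S1 SM PM h.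
have /choice [s sP] : forall i, exists s, S s /\ P i s by move=> i; have [s] := h i; exists s.
exists (\prod_i s i); first by apply: big_ind => // i _; case: (sP i).
by move=> i; rewrite (bigD1 i) //= mulrC; apply: PM; case: (sP i).
Qed.

Section Span.
Variables (A : comNzRingType) (V : lmodType A).
Implicit Type gs : seq V.

Definition spanned gs x := exists c : 'I_(size gs) -> A, x = \sum_i c i *: gs`_i.

Lemma spanned_submod gs : is_submod (spanned gs).
Proof.
split.
- by exists (fun=> 0); rewrite big1 // => i _; rewrite scale0r.
- move=> _ _ [c ->] [d ->]; exists (fun i => c i + d i).
  by rewrite -big_split; apply: eq_bigr => i _; rewrite scalerDl.
- move=> a _ [c ->]; exists (fun i => a * c i).
  by rewrite scaler_sumr; apply: eq_bigr => i _; rewrite scalerA.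
Qed.

Lemma mem_spanned gs g : g \in gs -> spanned gs g.
Proof.
move=> gin; have lt : (index g gs < size gs)%N by rewrite index_mem.
exists (fun i => (i == Ordinal lt)%:R); rewrite (bigD1 (Ordinal lt)) //= eqxx scale1r nth_index //.
by rewrite big1 ?addr0 // => i /negPf ->; rewrite scale0r.
Qed.

Lemma is_submod_sum (P : V -> Prop) (I : Type) (l : seq I) (D : pred I) (f : I -> V) :
  is_submod P -> (forall i, D i -> P (f i)) -> P (\sum_(i <- l | D i) f i).
Proof. by move=> [P0 PD _] Pf; apply: big_ind. Qed.

Lemma spanned_min gs (P : V -> Prop) x :
  is_submod P -> (forall g, g \in gs -> P g) -> spanned gs x -> P x.
Proof.
move=> Ps Pg [c ->]; apply: is_submod_sum => // i _.
by case: Ps => _ _; apply; apply/Pg/mem_nth.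
Qed.

Lemma spanned_fg gs : fin_gen (submod (spanned_submod gs)).
Proof.
pose g (i : 'I_(size gs)) := mk_submod (spanned_submod gs) (mem_spanned (mem_nth 0 (ltn_ord i))).
exists (size gs), g => x; have [c ex] := submodP x; exists c; apply: val_inj.
by rewrite submod_val_sum ex; apply: eq_bigr => i _; rewrite submod_valZ.
Qed.
End Span.

Section Fractions.
Variable R : idomainType.
Local Notation F := {fraction R}.

Lemma frac_repr (x : F) : exists2 s, s != 0 & exists p, s%:F * x = p%:F.
Proof.
elim/quotW: x => y; exists (\d_y); first exact: denom_ratioP.
exists (\n_y); apply/eqP; rewrite !piE FracField.equivfE.
rewrite /FracField.mulf !numden_Ratio ?mulr1 ?mul1r ?oner_neq0 ?denom_ratioP //.
Qed.

Definition tofracV r (x : 'rV[R]_r) : 'rV[F]_r := map_mx (@FracField.tofrac R) x.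

Lemma tofracVD r (x y : 'rV[R]_r) : tofracV (x + y) = tofracV x + tofracV y.
Proof. exact: map_mxD. Qed.

Lemma tofracVZ r a (x : 'rV[R]_r) : tofracV (a *: x) = a%:F *: tofracV x.
Proof. exact: map_mxZ. Qed.

Lemma tofracV0 r : tofracV (0 : 'rV[R]_r) = 0.
Proof. exact: map_mx0. Qed.

Lemma tofracV_sum r I (l : seq I) (f : I -> 'rV[R]_r) :
  tofracV (\sum_(i <- l) f i) = \sum_(i <- l) tofracV (f i).
Proof. exact: raddf_sum. Qed.

Lemma tofracV_inj r : injective (@tofracV r).
Proof.
move=> x y /rowP e; apply/rowP=> i; have /eqP := e i.
by rewrite !mxE tofrac_eq => /eqP.
Qed.

Lemma tofracV_delta r i : tofracV (delta_mx 0 i : 'rV[R]_r) = delta_mx 0 i.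
Proof. exact: map_delta_mx. Qed.

Section Loc.
Variable m : R -> Prop.
Hypothesis mM : is_maximal_ideal m.
Local Notation Lm := (Loc m).

Lemma locvalD (a b : Lm) : locval (a + b) = locval a + locval b.
Proof. exact: (raddfD (val : Lm -> F)). Qed.

Lemma locvalM (a b : Lm) : locval (a * b) = locval a * locval b.
Proof. exact: (rmorphM (val : Lm -> F)). Qed.

Lemma locval0 : locval (0 : Lm) = 0.
Proof. exact: (raddf0 (val : Lm -> F)). Qed.

Lemma locval1 : locval (1 : Lm) = 1.
Proof. exact: (rmorph1 (val : Lm -> F)). Qed.

Lemma locval_inj : injective (@locval R m).
Proof. exact: val_inj. Qed.

Lemma loc_denP s : loc_den m s <-> ~ m s.
Proof.
split=> [[l [lP ->]]|ms].
  elim: l lP => [|a l IH] lP; first by rewrite big_nil; case: mM.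
  rewrite big_cons; apply: maximal_mulN => //; first by case: (lP a) => //; left.
  by apply: IH => x xl; apply: lP; right.
exists [:: s]; split; last by rewrite big_seq1.
by move=> x [<-|//]; split=> //; exact: maximal_neq0 mM ms.
Qed.

Lemma nmem1 : ~ m 1. Proof. by case: mM. Qed.
Lemma nmemM a b : ~ m a -> ~ m b -> ~ m (a * b). Proof. exact: maximal_mulN. Qed.
Lemma tofrac_nmem s : ~ m s -> s%:F != 0 :> F.
Proof. by move=> ms; rewrite tofrac_eq0; exact: maximal_neq0 mM ms. Qed.

Lemma Loc_repr (a : Lm) : exists2 s, ~ m s & exists p, s%:F * locval a = p%:F.
Proof.
have /asboolP [p [s [/loc_denP ms ->]]] := locvalP a.
by exists s => //; exists p; rewrite mulrCA divff ?mulr1 ?tofrac_nmem.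
Qed.

Lemma Loc_frac p s : ~ m s -> exists a : Lm, locval a = p%:F / s%:F.
Proof.
move=> ms; have h : (p%:F / s%:F : F) \in locP m.
  by apply/asboolP; exists p, s; split=> //; apply/loc_denP.
by exists (MkLoc h).
Qed.

Lemma toLoc_val p : locval (toLoc m p) = p%:F. Proof. by []. Qed.

(** The localization X_m, realized inside F^r. *)
Definition local_hull r (X : 'rV[R]_r -> Prop) (v : 'rV[F]_r) :=
  exists s x, [/\ ~ m s, X x & s%:F *: v = tofracV x].

(** [phi] identifies M with X_m inside F^r. *)
Definition is_model (M : lmodType Lm) r (X : 'rV[R]_r -> Prop) (phi : M -> 'rV[F]_r) :=
  [/\ (forall x y, phi (x + y) = phi x + phi y),
      (forall a x, phi (a *: x) = locval a *: phi x),
      (forall x, phi x = 0 -> x = 0) &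
      (forall v, (exists y, phi y = v) <-> local_hull X v)].

(** The first clause makes X agree with R^r at every maximal ideal other than [m]; the second makes
    X_m isomorphic to M. *)
Lemma exists_model (M : lmodType Lm) r : h_local R ->
  fin_gen M -> torsion_free M -> has_rank (@locval R m) M r ->
  exists gs : seq 'rV[R]_r,
    (forall m', is_maximal_ideal m' -> ~ same_ideal m' m ->
      exists u, ~ m' u /\ forall x, spanned gs (u *: x)) /\
    exists phi, @is_model M r (spanned gs) phi.
Proof.
move=> hl [n [g gP]] tf [phi0 [phi0D phi0Z phi0S phi0K]].
have locval_neq0 (a : Lm) : a != 0 -> locval a != 0.
  by apply: contraNneq => e; apply/eqP/locval_inj; rewrite e locval0.
(* [c] is a common denominator of the coordinates of the generators; scaling by it places M inside
   R_m^r. *)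
have [c c0 cP] : exists2 c, c != 0 & forall i : 'I_n * 'I_r,
    exists p, c%:F * phi0 (g i.1) 0 i.2 = p%:F.
  apply: (@common_multiplier R (fun s => s != 0) _
    (fun i c => exists p, c%:F * phi0 (g i.1) 0 i.2 = p%:F)).
  - exact: oner_neq0.
  - by move=> a b; exact: mulf_neq0.
  - by move=> i a s [p e]; exists (a * p); rewrite !tofracM -e mulrA.
  - by move=> i; exact: frac_repr.
have /choice [p pP] := cP.
pose gg j : 'rV[R]_r := \row_i p (j, i).
pose phi x := c%:F *: phi0 x.
have cF0 : c%:F != 0 :> F by rewrite tofrac_eq0.
have phig j : phi (g j) = tofracV (gg j).
  by apply/rowP=> i; rewrite !mxE -pP.
have phiD x y : phi (x + y) = phi x + phi y by rewrite /phi phi0D scalerDr.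
have phiZ a x : phi (a *: x) = locval a *: phi x.
  by rewrite /phi phi0Z !scalerA mulrC.
have phi0' : phi 0 = 0 by rewrite -(scale0r 0) phiZ locval0 scale0r.
have phiK x : phi x = 0 -> x = 0.
  move/eqP; rewrite scaler_eq0 (negPf cF0) /= => /eqP /phi0K [s [s0]]; exact: tf.
have phi_sum I (l : seq I) (f : I -> M) : phi (\sum_(i <- l) f i) = \sum_(i <- l) phi (f i).
  by elim: l => [|a l IH]; rewrite ?big_nil // !big_cons phiD IH.
(* [sigma] bounds M from below: sigma R_m^r is contained in the image of [phi]. *)
have [sigma sn0 /choice [y yP]] : exists2 s, s != 0 & forall i : 'I_r,
    exists y, s%:F *: delta_mx 0 i = phi y.
  apply: (@common_multiplier R (fun s => s != 0) _
    (fun i s => exists y, s%:F *: delta_mx 0 i = phi y)).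
  - exact: oner_neq0.
  - by move=> a b; exact: mulf_neq0.
  - move=> i a s [z e]; exists (toLoc m a *: z).
    by rewrite phiZ -e scalerA toLoc_val tofracM.
  - move=> i; have [z [a [a0 e]]] := phi0S (delta_mx 0 i).
    have [s ms [q eqa]] := Loc_repr a.
    exists (c * q).
      rewrite mulf_neq0 // -tofrac_eq0 -eqa mulf_neq0 ?tofrac_nmem // locval_neq0.
    exists (toLoc m s *: z); rewrite phiZ /phi -e !scalerA toLoc_val tofracM -eqa.
    by congr (_ *: _); ring.
have [us [us1 us2]] := h_local_multipliers hl mM sn0.
(* The vectors u delta_i make X free away from [m]. At [m] they add nothing: t u is a multiple of
   [sigma] for some t outside [m], so u delta_i is already in the image of [phi]. *)
pose gs := [seq gg j | j <- enum 'I_n] ++ [seq u *: delta_mx 0 i | u <- us, i <- enum 'I_r].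
have sub := spanned_submod gs.
exists gs; split.
  move=> m' m'M neq; have [u uus mu] := us2 m' m'M neq; exists u; split=> // x.
  rewrite [x]row_sum_delta scaler_sumr; apply: is_submod_sum => // i _.
  rewrite scalerA mulrC -scalerA; case: sub => _ _; apply; apply: mem_spanned.
  by rewrite mem_cat; apply/orP; right; apply/allpairsP; exists (u, i); rewrite mem_enum.
exists phi; split=> // v; split.
  move=> [x <-]; have [d ->] := gP x.
  have [s ms /choice [q qP]] : exists2 s, ~ m s & forall j : 'I_n, exists q, s%:F * locval (d j) = q%:F.
    apply: (@common_multiplier R (fun s => ~ m s) _
      (fun j s => exists q, s%:F * locval (d j) = q%:F)).
    - exact: nmem1.
    - exact: nmemM.
    - by move=> i a s [q e]; exists (a * q); rewrite !tofracM -e mulrA.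
    - by move=> i; exact: Loc_repr.
  exists s, (\sum_j q j *: gg j); split=> //.
    apply: is_submod_sum => // j _; case: sub => _ _; apply; apply: mem_spanned.
    by rewrite mem_cat map_f // mem_enum.
  rewrite phi_sum scaler_sumr tofracV_sum; apply: eq_bigr => j _.
  by rewrite phiZ scalerA qP tofracVZ phig.
move=> [s [x [ms Xx e]]].
have [w ew] : exists w, phi w = tofracV x.
  apply: (spanned_min (gs := gs) (P := fun x => exists w, phi w = tofracV x)) Xx.
    split; first by exists 0; rewrite phi0' tofracV0.
      by move=> x1 x2 [w1 e1] [w2 e2]; exists (w1 + w2); rewrite phiD tofracVD e1 e2.
    by move=> a x1 [w e1]; exists (toLoc m a *: w); rewrite phiZ tofracVZ e1.
  move=> h; rewrite mem_cat => /orP [/mapP [j _ ->]|/allpairsP [[u i] /= [uus _ ->]]].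
    by exists (g j).
  have [t [a [mt e1]]] := us1 u uus.
  have [b eb] := Loc_frac a mt.
  exists (b *: y i); rewrite phiZ -yP tofracVZ tofracV_delta scalerA eb; congr (_ *: _).
  by apply: (mulfI (tofrac_nmem mt)); rewrite -tofracM e1 tofracM mulrA mulrCA divff ?mulr1 ?tofrac_nmem.
have [b eb] := Loc_frac 1 ms.
exists (b *: w); rewrite phiZ ew -e scalerA eb tofrac1 mul1r mulVf ?scale1r ?tofrac_nmem //.
Qed.
End Loc.
End Fractions.

(** * Endomorphisms of a module realized inside F^r *)

Section Model.
Variables (R : idomainType) (m : R -> Prop) (mM : is_maximal_ideal m).
Local Notation F := {fraction R}.

Lemma subgroup_local_hull r (X : 'rV[R]_r -> Prop) :
  is_submod X -> subgroup (local_hull m X).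
Proof.
move=> [X0 XD XZ]; split.
  by exists 1, 0; split=> //; [exact: nmem1 | rewrite scaler0 tofracV0].
move=> u v [s [x [ms Xx eu]]] [t [y [mt Xy ev]]].
exists (s * t), (t *: x + (- s) *: y); split; first exact: nmemM.
  by apply: XD; apply: XZ.
by rewrite tofracVD !tofracVZ -eu -ev !scalerA tofracM tofracN scalerBr mulrC mulNr scaleNr mulrC.
Qed.

Variables (M : lmodType (Loc m)) (r : nat) (X : 'rV[R]_r -> Prop) (phi : M -> 'rV[F]_r).
Hypothesis Mphi : is_model X phi.

Lemma model0 : phi 0 = 0.
Proof. by case: Mphi => _ phiZ _ _; rewrite -(scale0r 0) phiZ locval0 scale0r. Qed.

Lemma modelB x y : phi (x - y) = phi x - phi y.
Proof.
case: Mphi => phiD _ _ _; apply: (addIr (phi y)).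
by rewrite -phiD !subrK.
Qed.

Lemma model_inj : injective phi.
Proof.
case: (Mphi) => _ _ phiK _ x y e; apply/eqP; rewrite -subr_eq0; apply/eqP/phiK.
by rewrite modelB e subrr.
Qed.

Lemma model_toLoc x : X x -> exists y, phi y = tofracV x.
Proof.
case: (Mphi) => _ _ _ phiI Xx; apply/phiI; exists 1, x.
by split=> //; [exact: nmem1 | rewrite tofrac1 scale1r].
Qed.

Lemma model_clear y : exists s x, [/\ ~ m s, X x & phi (toLoc m s *: y) = tofracV x].
Proof.
case: (Mphi) => _ phiZ _ phiI.
have [s [x [ms Xx e]]] : local_hull m X (phi y) by apply/phiI; exists y.
by exists s, x; rewrite phiZ.
Qed.

(** A matrix preserving X_m lifts along the injection [phi] to an endomorphism f of M, and f or 1 -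
    f is bijective. The corresponding matrix is then invertible because X contains the multiples u
    delta_i of a basis. *)
Lemma model_local_stabilizer u : u != 0 -> (forall x, X (u *: x)) ->
  local_end M -> local_stabilizer (local_hull m X).
Proof.
move=> u0 uX [_ lM] A pA; case: (Mphi) => phiD phiZ phiK phiI.
have invertible (B : 'M[F]_r) (g : M -> M) : bijective g ->
    (forall y, phi (g y) = phi y *m B) ->
    B \in unitmx /\ preserves (local_hull m X) (invmx B).
  move=> [h hK gK] gB; have pre y : phi (h y) *m B = phi y by rewrite -gB gK.
  have uB : B \in unitmx.
    have /choice [w wP] : forall i : 'I_r, exists w : 'rV[F]_r, w *m B = delta_mx 0 i.
      move=> i; have [y ey] := model_toLoc (uX (delta_mx 0 i)).
      exists (u%:F^-1 *: phi (h y)); rewrite -scalemxAl pre ey tofracVZ tofracV_delta.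
      by rewrite scalerA mulVf ?scale1r // tofrac_eq0.
    suff /mulmx1_unit [] : (\matrix_i w i) *m B = 1%:M by [].
    by apply/row_matrixP=> i; rewrite row_mul rowK wP row1.
  by split=> // v /phiI [y <-]; rewrite -pre mulmxK //; apply/phiI; exists (h y).
have /choice [f fP] : forall y, exists z, phi z = phi y *m A.
  by move=> y; apply/phiI/pA/phiI; exists y.
have flin : is_linear_map f.
  split=> [x y|a x]; apply: model_inj; first by rewrite fP !phiD mulmxDl !fP.
  by rewrite fP !phiZ fP scalemxAl.
case: (lM f flin) => bf; [left|right]; apply: invertible bf _ => y //.
by rewrite modelB fP mulmxBr mulmx1.
Qed.
End Model.

(** * Localizations and indecomposability of the realized module *)

Section Genus.
Variables (R : idomainType) (m : R -> Prop) (mM : is_maximal_ideal m).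
Local Notation F := {fraction R}.
Variables (M : lmodType (Loc m)) (r : nat) (gs : seq 'rV[R]_r) (phi : M -> 'rV[F]_r).
Hypothesis Mphi : is_model (spanned gs) phi.
Local Notation X := (submod (spanned_submod gs)).

Lemma submod_torsion_free : torsion_free X.
Proof.
move=> a x a0 /(congr1 val); rewrite submod_valZ submod_val0 => e; apply: val_inj.
rewrite submod_val0; apply/rowP=> i; have := congr1 (fun v : 'rV_r => v 0 i) e.
by rewrite !mxE => /eqP; rewrite mulf_eq0 (negPf a0) => /eqP.
Qed.

Lemma model_localization : exists psi : X -> M,
  (forall x, phi (psi x) = tofracV (val x)) /\
  is_localization (@toLoc R m) (fun s => ~ m s) psi.
Proof.
case: (Mphi) => phiD phiZ phiK phiI.
have /choice [psi psiP] : forall x : X, exists y, phi y = tofracV (val x).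
  by move=> x; apply: (model_toLoc mM Mphi (submodP x)).
exists psi; split=> //; split.
- by move=> x y; apply: (model_inj Mphi); rewrite phiD !psiP submod_valD tofracVD.
- by move=> a x; apply: (model_inj Mphi); rewrite phiZ !psiP submod_valZ tofracVZ.
- move=> y; have [s [x [ms Xx e]]] := model_clear Mphi y.
  exists (mk_submod (spanned_submod gs) Xx), s; split=> //.
  by apply: (model_inj Mphi); rewrite psiP e.
- move=> x e; exists 1; split; first exact: nmem1.
  rewrite scale1r; apply: val_inj; rewrite submod_val0; apply: tofracV_inj.
  by rewrite -psiP e (model0 Mphi) tofracV0.
Qed.

(** A decomposition of X localizes to one of M, where one summand vanishes; the matching summand of
    X vanishes too, since X is torsion-free and hence embeds in M. *)
Lemma model_indecomposable : indecomposable M -> indecomposable X.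
Proof.
case=> [[x0 x0n] Mind]; case: (Mphi) => phiD phiZ phiK phiI.
have [psi [psiP [psiD psiZ psiS psiK]]] := model_localization.
have psi_inj x : psi x = 0 -> x = 0.
  by move=> /psiK [s [ms]]; apply: submod_torsion_free; exact: maximal_neq0 mM ms.
have psi0 : psi 0 = 0.
  by apply: (model_inj Mphi); rewrite psiP submod_val0 tofracV0 (model0 Mphi).
have toLoc_cancel s (y : M) : ~ m s -> toLoc m s *: y = 0 -> y = 0.
  move=> ms /(congr1 phi); rewrite phiZ (model0 Mphi) => /eqP.
  by rewrite scaler_eq0 toLoc_val (negPf (tofrac_nmem mM ms)) => /eqP /phiK.
split.
  have [x [s [ms e]]] := psiS x0; exists x; apply: contraNneq x0n => x_0.
  by apply/eqP; apply: (toLoc_cancel s) => //; rewrite e x_0 psi0.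
move=> P1 P2 sP1 sP2 dis sumP.
pose hull (P : X -> Prop) y := exists s x, [/\ ~ m s, P x & toLoc m s *: y = psi x].
have toLocM a b : toLoc m (a * b) = toLoc m a * toLoc m b.
  by apply: locval_inj; rewrite locvalM !toLoc_val tofracM.
have hull_sub P : is_submod P -> is_submod (hull P).
  move=> [P0 PD PZ]; split.
  - by exists 1, 0; split=> //; [exact: nmem1 | rewrite psi0 scaler0].
  - move=> y z [s [x [ms Px e]]] [t [w [mt Pw f]]]; exists (s * t), (t *: x + s *: w).
    split; [exact: nmemM | by apply: PD; apply: PZ | ].
    by rewrite psiD !psiZ -e -f !scalerA scalerDr toLocM [toLoc m t * _]mulrC.
  - move=> a y [s [x [ms Px e]]]; have [t mt [p ep]] := Loc_repr mM a.
    exists (s * t), (p *: x); split; [exact: nmemM | exact: PZ|].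
    rewrite psiZ -e !scalerA; congr (_ *: _); apply: locval_inj.
    by rewrite !locvalM !toLoc_val -ep tofracM; ring.
have hull0 P : (forall y, hull P y -> y = 0) -> forall x, P x -> x = 0.
  move=> h x Px; apply: psi_inj; apply: h; exists 1, x; split=> //; first exact: nmem1.
  suff -> : toLoc m 1 = 1 by rewrite scale1r.
  by apply: locval_inj; rewrite locval1 toLoc_val tofrac1.
have [||||/hull0|/hull0] := Mind (hull P1) (hull P2); [exact: hull_sub|exact: hull_sub| | |by left|by right].
  move=> y [s [x [ms P1x e]]] [t [w [mt P2w f]]].
  have etx : t *: x = s *: w.
    apply/eqP; rewrite -subr_eq0; apply/eqP/psi_inj.
    rewrite -scaleNr psiD !psiZ -e -f !scalerA -scalerDl.
    suff -> : toLoc m t * toLoc m s + toLoc m (- s) * toLoc m t = 0 by rewrite scale0r.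
    by apply: locval_inj; rewrite locvalD !locvalM locval0 !toLoc_val tofracN; ring.
  have x_0 : x = 0.
    apply: (submod_torsion_free (maximal_neq0 mM mt)); apply: dis.
      by case: sP1 => _ _; apply.
    by rewrite etx; case: sP2 => _ _; apply.
  by apply: (toLoc_cancel s) => //; rewrite e x_0 psi0.
move=> y; have [x [s [ms e]]] := psiS y.
have [x1 [x2 [P1x P2x ex]]] := sumP x.
have [b eb] := Loc_frac mM 1 ms.
have bs : toLoc m s * b = 1.
  by apply: locval_inj; rewrite locvalM locval1 toLoc_val eb tofrac1 mul1r divff ?(tofrac_nmem mM).
exists (b *: psi x1), (b *: psi x2); split.
- by exists s, x1; rewrite scalerA bs scale1r.
- by exists s, x2; rewrite scalerA bs scale1r.
- by rewrite -scalerDr -psiD -ex -e scalerA mulrC bs scale1r.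
Qed.

(** Induced by the inclusion of X in R^r: u R^r lies in X and u is invertible at [m'], so localizing
    fills the whole free module. *)
Lemma free_localization m' : is_maximal_ideal m' ->
  (exists u, ~ m' u /\ forall x, spanned gs (u *: x)) ->
  exists psi : X -> 'rV[Loc m']_r, is_localization (@toLoc R m') (fun s => ~ m' s) psi.
Proof.
move=> m'M [u [mu uX]].
exists (fun x : X => \row_i toLoc m' ((val x : 'rV[R]_r) 0 i)); split.
- move=> x y; apply/rowP=> i; rewrite [LHS]mxE submod_valD !mxE.
  by apply: locval_inj; rewrite locvalD !toLoc_val tofracD.
- move=> a x; apply/rowP=> i; rewrite [LHS]mxE submod_valZ !mxE.
  by apply: locval_inj; rewrite locvalM !toLoc_val tofracM.
- move=> y.
  have [s ms /choice [p pP]] : exists2 s, ~ m' s & forall i : 'I_r,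
      exists p, s%:F * locval (y 0 i) = p%:F.
    apply: (@common_multiplier R (fun s => ~ m' s) _
      (fun i s => exists p, s%:F * locval (y 0 i) = p%:F)).
    - exact: nmem1.
    - exact: nmemM.
    - by move=> i a s [q e]; exists (a * q); rewrite !tofracM -e mulrA.
    - by move=> i; exact: Loc_repr.
  exists (mk_submod (spanned_submod gs) (uX (\row_i p i))), (u * s).
  split; first exact: nmemM.
  apply/rowP=> i; rewrite !mxE; apply: locval_inj.
  by rewrite locvalM !toLoc_val !tofracM -pP mulrA.
- move=> x e; exists 1; split; first exact: nmem1.
  rewrite scale1r; apply: val_inj; rewrite submod_val0; apply/rowP=> i.
  have := congr1 (fun v : 'rV[Loc m']_r => locval (v 0 i)) e.
  by rewrite !mxE toLoc_val locval0 => /eqP; rewrite tofrac_eq0 => /eqP.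
Qed.

Lemma model_genus : indecomposable M ->
  (forall m', is_maximal_ideal m' -> ~ same_ideal m' m ->
      exists u, ~ m' u /\ forall x, spanned gs (u *: x)) ->
  genus_cond M r X.
Proof.
move=> Mind cX; split.
- exact: spanned_fg.
- exact: model_indecomposable.
- exact: submod_torsion_free.
- by have [psi [_ ?]] := model_localization; exists psi.
- by move=> m' m'M neq; apply: free_localization => //; exact: cX.
Qed.
End Genus.

(** * Direct sum decompositions *)

Lemma InP (T : eqType) (x : T) l : List.In x l <-> x \in l.
Proof.
elim: l => [|a l IH] //=; rewrite inE; split.
  by case=> [->|/IH ->]; rewrite ?eqxx ?orbT.
by case/orP => [/eqP ->|/IH]; [left|right].
Qed.

Lemma uniq_NoDup (T : eqType) (l : seq T) : uniq l -> List.NoDup l.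
Proof.
elim: l => [|a l IH] /=; first by constructor.
by case/andP => al ul; constructor; [apply/InP/negP | exact: IH].
Qed.

Lemma big_supp (V : nmodType) (J : eqType) (l L : seq J) (y : J -> V) :
  uniq l -> uniq L -> {subset l <= L} -> (forall j, j \notin l -> y j = 0) ->
  \sum_(j <- L) y j = \sum_(j <- l) y j.
Proof.
move=> ul uL sub y0; rewrite (bigID (mem l)) /= [X in _ + X]big1 ?addr0; last by move=> j /y0.
rewrite -big_filter; apply: perm_big; apply: uniq_perm; rewrite ?filter_uniq // => j.
by rewrite mem_filter; apply/andP/idP => [[]|jl] //; split=> //; apply: sub.
Qed.

(** Replaces the family of submodules by its idempotent component maps, which can be turned into
    matrices. *)
Lemma dsum_projections (A : comNzRingType) (N : lmodType A) : dsum_of_fg N ->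
  exists (J : Type) (e : J -> N -> N),
  [/\ forall j, is_linear_map (e j),
      forall j x, e j (e j x) = e j x,
      forall j, exists n (g : 'I_n -> N), forall x, exists c : 'I_n -> A,
        e j x = \sum_i c i *: g i &
      forall x, exists l : seq J, x = \sum_(j <- l) e j x].
Proof.
(* Classical decidable equality on the index type allows removing duplicates from lists. *)
case=> J0 [P0 [Psub0 Pgen0 Pind0]]; pose J : eqType := {classic J0}.
pose P : J -> N -> Prop := P0.
have Psub : forall j, is_submod (P j) := fun j => (Psub0 j).1.
have Pgen : forall x, exists (l : seq J) (y : J -> N), (forall j, P j (y j)) /\ x = \sum_(j <- l) y j.
  exact: Pgen0.
have Pind : forall (l : seq J) (y : J -> N), uniq l -> (forall j, P j (y j)) ->
    \sum_(j <- l) y j = 0 -> forall j, j \in l -> y j = 0.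
  by move=> l y ul Py y0 j /InP; apply: Pind0 => //; exact: (@uniq_NoDup J).
(* [y] is the finitely supported family of components of [x]; [decE] is its uniqueness. *)
pose dec x (y : J -> N) := (forall j, P j (y j)) /\
  exists l, [/\ uniq l, forall j, j \notin l -> y j = 0 & x = \sum_(j <- l) y j].
have decE x y y' j : dec x y -> dec x y' -> y j = y' j.
  move=> [Py [l [ul yl ex]]] [Py' [l' [ul' yl' ex']]].
  pose L := undup (l ++ l').
  have zero : \sum_(j <- L) (y j - y' j) = 0.
    rewrite sumrB (big_supp ul (undup_uniq _)) // => [|k kl]; last by rewrite mem_undup mem_cat kl.
    rewrite (big_supp ul' (undup_uniq _)) // => [|k kl]; last by rewrite mem_undup mem_cat kl orbT.
    by rewrite -ex -ex' subrr.
  have Pd k : P k (y k - y' k).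
    by have [_ PD PZ] := Psub k; rewrite -scaleN1r; apply: PD => //; apply: PZ.
  have [jL|] := boolP (j \in L).
    by apply/eqP; rewrite -subr_eq0; apply/eqP; apply: Pind zero _ _ => //; exact: undup_uniq.
  by rewrite mem_undup mem_cat negb_or => /andP [/yl -> /yl' ->].
have /choice [y yP] : forall x, exists y, dec x y.
  move=> x; have [l [y [Py ex]]] := Pgen x.
  (* The given list may repeat an index; multiplicities merge the repetitions. *)
  exists (fun j => y j *+ count_mem j l); split.
    by move=> j; rewrite -scaler_nat; have [_ _ PZ] := Psub j; apply: PZ.
  exists (undup l); split; first exact: undup_uniq.
    by move=> j; rewrite mem_undup => /count_memPn ->.
  by rewrite ex -big_undup_iterop_count.
exists J, (fun j x => y x j); split.
- move=> j; split=> [x x'|a x].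
    apply: (decE (x + x') _ (fun k => y x k + y x' k)); first exact: yP.
    have [Py [l [ul yl ex]]] := yP x; have [Py' [l' [ul' yl' ex']]] := yP x'.
    split=> [k|]; first by have [_ PD _] := Psub k; apply: PD.
    exists (undup (l ++ l')); split; first exact: undup_uniq.
      by move=> k; rewrite mem_undup mem_cat negb_or => /andP [/yl -> /yl' ->]; rewrite addr0.
    rewrite big_split /=.
    rewrite (big_supp ul (undup_uniq _)) // => [|k kl]; last by rewrite mem_undup mem_cat kl.
    by rewrite (big_supp ul' (undup_uniq _)) -?ex -?ex' // => k kl; rewrite mem_undup mem_cat kl orbT.
  apply: (decE (a *: x) _ (fun k => a *: y x k)); first exact: yP.
  have [Py [l [ul yl ex]]] := yP x.
  split=> [k|]; first by have [_ _ PZ] := Psub k; apply: PZ.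
  exists l; split=> // [k /yl ->|]; first by rewrite scaler0.
  by rewrite {1}ex scaler_sumr.
(* An element of the j-th summand has the family concentrated at [j] as its components. *)
- move=> j x; have := @decE (y x j) _ (fun k => if k == j then y x j else 0) j (yP _).
  rewrite eqxx; apply; split=> [k|].
    by case: eqP => [->|_]; [case: (yP x) | case: (Psub k)].
  exists [:: j]; split=> // [k|]; first by rewrite inE => /negPf ->.
  by rewrite big_seq1 eqxx.
- move=> j; have [_ [n [g [_ gP]]]] := Psub0 j; exists n, g => x.
  by apply: gP; have [Py _] := yP x; apply: Py.
- by move=> x; have [_ [l [_ _ ex]]] := yP x; exists l.
Qed.

(** * The glued module *)

Section Glue.
Variable R : idomainType.

(** Polynomials stand for R^(nat); after an offset [o] the coefficients are cut into consecutive
    rows of length [r]. *)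
Definition block o r j (p : {poly R}) : 'rV[R]_r := \row_i p`_(o + (j * r + i)).

Lemma blockD o r j p q : block o r j (p + q) = block o r j p + block o r j q.
Proof. by apply/rowP=> i; rewrite !mxE coefD. Qed.

Lemma blockZ o r j a p : block o r j (a *: p) = a *: block o r j p.
Proof. by apply/rowP=> i; rewrite !mxE coefZ. Qed.

Lemma block0 o r j : block o r j 0 = 0.
Proof. by apply/rowP=> i; rewrite !mxE coef0. Qed.

Lemma block_eq0 o r j (p : {poly R}) : (size p <= j)%N -> block o r j p = 0.
Proof.
move=> sp; apply/rowP=> i; rewrite !mxE nth_default // (leq_trans sp) //.
have := ltn_ord i; nia.
Qed.

Variables (r1 r2 : nat) (X1 : 'rV[R]_r1 -> Prop) (X2 : 'rV[R]_r2 -> Prop).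
Hypotheses (sX1 : is_submod X1) (sX2 : is_submod X2).

(** The offsets 0 and 1 differ so that ranks will be multiples of [r1] on one side and 1 plus
    multiples of [r2] on the other. *)
Definition glued (p : {poly R}) :=
  (forall j, X1 (block 0 r1 j p)) /\ (forall j, X2 (block 1 r2 j p)).

Lemma glued_submod : is_submod glued.
Proof.
have [X10 X1D X1Z] := sX1; have [X20 X2D X2Z] := sX2; split.
- by split=> j; rewrite block0.
- by move=> p q [p1 p2] [q1 q2]; split=> j; rewrite blockD; [exact: X1D | exact: X2D].
- by move=> a p [p1 p2]; split=> j; rewrite blockZ; [exact: X1Z | exact: X2Z].
Qed.

Local Notation N := (submod glued_submod).
Local Notation Y1 := (submod sX1).
Local Notation Y2 := (submod sX2).

Variables (j1 j2 : R).
Hypotheses (r1_gt0 : (0 < r1)%N) (r2_gt0 : (0 < r2)%N).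
Hypotheses (j1X : forall x, X1 (j1 *: x)) (j2X : forall x, X2 (j2 *: x)) (j12 : j1 + j2 = 1).

Let ord1 i : 'I_r1 := Ordinal (ltn_pmod i r1_gt0).
Let ord2 i : 'I_r2 := Ordinal (ltn_pmod i r2_gt0).
Let row1 (x : Y1) : 'rV[R]_r1 := val x.
Let row2 (x : Y2) : 'rV[R]_r2 := val x.

(* N is the intersection of two submodules of R^(nat): the families whose blocks
   0..r1-1, r1..2r1-1, ... lie in X1, and those whose blocks 1..r2, r2+1..2r2, ...
   lie in X2. [asm1 f] and [asm2 f] are the elements y of the former and z of the
   latter with components f, and [assemble] is the retraction j2 y + j1 z. *)
Let asm1 (f : option nat -> (Y1 * Y2)%type) (i : nat) : R :=
  row1 (f (Some (i %/ r1)%N)).1 0 (ord1 i).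
Let asm2 (f : option nat -> (Y1 * Y2)%type) (i : nat) : R :=
  if i is i'.+1 then row2 (f (Some (i' %/ r2)%N)).2 0 (ord2 i')
  else row1 (f None).1 0 (ord1 0) + row2 (f None).2 0 (ord2 0).
Let assemble f i := j2 * asm1 f i + j1 * asm2 f i.

Let divmod_row r (r_gt0 : (0 < r)%N) j (i : 'I_r) :
  ((j * r + i) %/ r = j)%N /\ Ordinal (ltn_pmod (j * r + i) r_gt0) = i.
Proof.
split; first by rewrite divnMDl // divn_small ?addn0.
by apply: val_inj; rewrite /= modnMDl modn_small.
Qed.

Let assemble_glued f : fin_supp (X := (Y1 * Y2)%type) f ->
  exists p : N, forall i, (val p)`_i = assemble f i.
Proof.
case=> l lP.
have [B BP] : exists B, forall k, (B <= k)%N -> f (Some k) = 0.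
  have [B BP] : exists B, forall k, List.In (Some k) l -> (k < B)%N.
    elim: l {lP} => [|o l [B BP]]; first by exists 0.
    exists (maxn B (odflt 0 o).+1)%N => k /= [->|/BP]; rewrite /=; lia.
  by exists B => k Bk; apply: lP => /BP; lia.
(* From this index on, both kinds of blocks have index at least [B], the leading coordinate
   included. *)
pose n := (1 + (B * r1 + B * r2))%N.
have out i : (n <= i)%N -> assemble f i = 0.
  case: i => [|i]; first by rewrite /n; lia.
  move=> ni; have lt1 : (B <= i.+1 %/ r1)%N by rewrite leq_divRL // /n in ni *; lia.
  have lt2 : (B <= i %/ r2)%N by rewrite leq_divRL // /n in ni *; lia.
  by rewrite /assemble /asm1 /asm2 !BP // /row1 /row2 !submod_val0 !mxE !mulr0 addr0.
pose p := \poly_(i < n) assemble f i.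
have cp i : p`_i = assemble f i.
  by rewrite coef_poly; case: ltnP => // /out.
have [_ X1D X1Z] := sX1; have [_ X2D X2Z] := sX2.
(* In each block one term is a multiple of an element of X1 (or X2), and the other is in it because
   [j1] (or [j2]) multiplies every row into it. *)
have gp : glued p.
  split=> j.
    have -> : block 0 r1 j p = j2 *: row1 (f (Some j)).1 + j1 *: \row_i asm2 f (j * r1 + i).
      apply/rowP=> i; rewrite !mxE cp /assemble /asm1 add0n.
      by have [-> e] := divmod_row r1_gt0 j i; rewrite /ord1 e.
    by apply: X1D; [apply: X1Z; exact: submodP | exact: j1X].
  have -> : block 1 r2 j p = j2 *: (\row_i asm1 f (1 + (j * r2 + i))) + j1 *: row2 (f (Some j)).2.
    apply/rowP=> i; rewrite !mxE cp /assemble add1n /asm2.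
    by have [-> e] := divmod_row r2_gt0 j i; rewrite /ord2 e.
  by apply: X2D; [exact: j2X | apply: X2Z; exact: submodP].
by exists (mk_submod glued_submod gp).
Qed.

(** The index [Some j] carries the j-th blocks. [None] carries the coefficient p_0, split as j1 p_0
    in X1 and j2 p_0 in X2 and recovered as their sum: this exhibits R as a summand of the direct
    sum of X1 and X2. *)
Lemma glued_in_Add : in_Add (Y1 * Y2)%type N.
Proof.
have /choice [pi piP] : forall f, exists p : N,
    fin_supp (X := (Y1 * Y2)%type) f -> forall i, (val p)`_i = assemble f i.
  move=> f; have [ff|nf] := pselect (fin_supp (X := (Y1 * Y2)%type) f); last by exists 0.
  by have [p pP] := assemble_glued ff; exists p.
pose head r (r_gt0 : (0 < r)%N) (p : {poly R}) : 'rV[R]_r :=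
  p`_0 *: delta_mx 0 (Ordinal (ltn_pmod 0 r_gt0)).
pose io (p : N) (o : option nat) : (Y1 * Y2)%type :=
  if o is Some j then (mk_submod sX1 ((submodP p).1 j), mk_submod sX2 ((submodP p).2 j))
  else (mk_submod sX1 (j1X (head r1 r1_gt0 (val p))), mk_submod sX2 (j2X (head r2 r2_gt0 (val p)))).
have fsD f g : fin_supp (X := (Y1 * Y2)%type) f -> fin_supp (X := (Y1 * Y2)%type) g ->
    fin_supp (X := (Y1 * Y2)%type) (fun i => f i + g i).
  move=> [l lP] [l' lP']; exists (l ++ l')%list => i il.
  by rewrite lP ?lP' ?addr0 // => h; apply: il; apply/List.in_or_app; [right|left].
have fsZ a f : fin_supp (X := (Y1 * Y2)%type) f ->
    fin_supp (X := (Y1 * Y2)%type) (fun i => a *: f i).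
  by move=> [l lP]; exists l => i il; rewrite lP // scaler0.
have fsio p : fin_supp (X := (Y1 * Y2)%type) (io p).
  exists (None :: [seq Some i | i <- List.seq 0 (size (val p))]) => -[j|] nl; last by case: nl; left.
  have sp : (size (val p) <= j)%N.
    rewrite leqNgt; apply/negP=> lt; apply: nl; right.
    by apply/List.in_map/List.in_seq; lia.
  by congr (_, _); apply: val_inj; rewrite submod_val0 /= block_eq0.
have pair_inj (u v : (Y1 * Y2)%type) : val u.1 = val v.1 -> val u.2 = val v.2 -> u = v.
  by case: u v => [u1 u2] [v1 v2] /= e1 e2; congr (_, _); apply: val_inj.
have addE (u v : (Y1 * Y2)%type) : (u + v).1 = u.1 + v.1 /\ (u + v).2 = u.2 + v.2 by [].
have scaleE a (u : (Y1 * Y2)%type) : (a *: u).1 = a *: u.1 /\ (a *: u).2 = a *: u.2 by [].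
have ioE p j : val (io p (Some j)).1 = block 0 r1 j (val p) /\
    val (io p (Some j)).2 = block 1 r2 j (val p) by [].
have ioE0 p : val (io p None).1 = j1 *: head r1 r1_gt0 (val p) /\
    val (io p None).2 = j2 *: head r2 r2_gt0 (val p) by [].
have headD r r_gt0 p q : head r r_gt0 (p + q) = head r r_gt0 p + head r r_gt0 q.
  by rewrite /head coefD scalerDl.
have headZ r r_gt0 a p : head r r_gt0 (a *: p) = a *: head r r_gt0 p.
  by rewrite /head coefZ scalerA.
exists (option nat), io, pi; split.
- split=> // x y [j|]; apply: pair_inj; rewrite ?(addE _ _).1 ?(addE _ _).2 submod_valD.
  + by rewrite !(ioE _ _).1 submod_valD blockD.
  + by rewrite !(ioE _ _).2 submod_valD blockD.
  + by rewrite !(ioE0 _).1 submod_valD headD scalerDr.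
  + by rewrite !(ioE0 _).2 submod_valD headD scalerDr.
- move=> a x [j|]; apply: pair_inj; rewrite ?(scaleE _ _).1 ?(scaleE _ _).2 submod_valZ.
  + by rewrite !(ioE _ _).1 submod_valZ blockZ.
  + by rewrite !(ioE _ _).2 submod_valZ blockZ.
  + by rewrite !(ioE0 _).1 submod_valZ headZ scalerA mulrC -scalerA.
  + by rewrite !(ioE0 _).2 submod_valZ headZ scalerA mulrC -scalerA.
- move=> f g ff fg; apply: val_inj; apply/polyP=> i.
  rewrite submod_valD coefD !piP //; last exact: fsD.
  rewrite /assemble /asm1 /asm2 /row1 /row2.
  by case: i => [|i]; rewrite ?submod_valD !mxE; ring.
- move=> a f ff; apply: val_inj; apply/polyP=> i.
  rewrite submod_valZ coefZ !piP //; last exact: fsZ.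
  rewrite /assemble /asm1 /asm2 /row1 /row2.
  by case: i => [|i]; rewrite ?submod_valZ !mxE; ring.
- move=> p; apply: val_inj; apply/polyP=> i; rewrite piP //.
  rewrite /assemble /asm1 /row1 /= mxE add0n -divn_eq.
  have -> : asm2 (io p) i = (val p)`_i.
    case: i => [|i]; rewrite /asm2 /row1 /row2 /= !mxE /=; last by rewrite add1n -divn_eq.
    by rewrite !eqxx !mulr1 -mulrDl j12 mul1r.
  by rewrite -mulrDl addrC j12 mul1r.
Qed.
End Glue.

(** * Powers of a lattice in terms of consecutive blocks *)

Section PowerLattice.
Variables (F : fieldType) (r : nat) (L : 'rV[F]_r -> Prop).

Lemma powL_rowP k (f : nat -> F) :
  powL L (\row_(i < k * r) f i) <->
  forall j, (j < k)%N -> L (\row_(i < r) f (j * r + i)%N).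
Proof.
elim: k f => [|k IH] f; first by split.
have el : lsubmx (\row_(i < r + k * r) f i) = \row_(i < r) f (0 * r + i)%N.
  by apply/rowP=> i; rewrite !mxE.
have er : rsubmx (\row_(i < r + k * r) f i) = \row_(i < k * r) f (r + i)%N.
  by apply/rowP=> i; rewrite !mxE.
have shift j : \row_(i < r) f (r + (j * r + i))%N = \row_(i < r) f (j.+1 * r + i)%N.
  by apply/rowP=> i; rewrite !mxE mulSn addnA.
split=> [[]|h].
  rewrite el er => L0 /(IH (fun i => f (r + i)%N)) Lk [|j] // jk.
  by rewrite -shift; apply: Lk.
split; first by rewrite el; apply: h.
by rewrite er; apply/(IH (fun i => f (r + i)%N)) => j jk; rewrite shift; apply: h.
Qed.
End PowerLattice.

(** * Matrices of idempotent endomorphisms with image of bounded degree *)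

Section Endomorphism.
Variables (R : idomainType) (P : {poly R} -> Prop) (sP : is_submod P).
Local Notation F := {fraction R}.
Local Notation N := (submod sP).
Variables (e : N -> N) (c : R) (n0 : nat).
Hypotheses (elin : is_linear_map e) (eidem : forall x, e (e x) = e x).
Hypotheses (c0 : c != 0) (cP : forall p, P (c *: p)).
Hypothesis (esize : forall x, (size (val (e x)) <= n0)%N).

Definition rowQ n (p : {poly R}) : 'rV[F]_n := \row_i (p`_i)%:F.

Let w i : N := mk_submod sP (cP 'X^i).

(** The monomial X^i may lie outside the module, but c X^i lies in it; hence the division by [c].
    Rows act from the left, and only the first [n] coordinates are kept. *)
Definition endo_mx n : 'M[F]_n := \matrix_(i, k) (((val (e (w i)))`_k)%:F / c%:F).

Let cF0 : c%:F != 0 :> F. Proof. by rewrite tofrac_eq0. Qed.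

Let e_sum (I : Type) (l : seq I) (f : I -> N) : e (\sum_(i <- l) f i) = \sum_(i <- l) e (f i).
Proof.
have [eD eZ] := elin; elim: l => [|a l IH]; last by rewrite !big_cons eD IH.
by rewrite !big_nil; have := eZ 0 0; rewrite !scale0r.
Qed.

Lemma endo_mxP n (x : N) : (size (val x) <= n)%N ->
  rowQ n (val (e x)) = rowQ n (val x) *m endo_mx n.
Proof.
move=> sx; have [eD eZ] := elin.
have ex : c *: x = \sum_(i < n) (val x)`_i *: w i.
  apply: val_inj; rewrite submod_valZ submod_val_sum; apply/polyP=> k.
  rewrite coefZ coef_sum.
  under eq_bigr => i _ do rewrite submod_valZ /= !coefZ coefXn mulrCA.
  rewrite -mulr_sumr; congr (_ * _); case: (ltnP k n) => kn.
    rewrite (bigD1 (Ordinal kn)) //= eqxx mulr1 big1 ?addr0 // => i.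
    by rewrite -val_eqE /= eq_sym => /negPf ->; rewrite mulr0.
  rewrite nth_default ?(leq_trans sx) // big1 // => i _.
  by rewrite gtn_eqF ?mulr0 // (leq_trans (ltn_ord i)).
apply/rowP=> k; rewrite !mxE; apply: (mulfI cF0).
rewrite -tofracM -coefZ -submod_valZ -eZ ex e_sum submod_val_sum coef_sum rmorph_sum mulr_sumr.
apply: eq_bigr => i _; rewrite !mxE eZ submod_valZ coefZ rmorphM /=.
by rewrite mulrCA [c%:F * _]mulrC divfK.
Qed.

Let row_endo n (i : 'I_n) : c%:F *: row i (endo_mx n) = rowQ n (val (e (w i))).
Proof. by apply/rowP=> k; rewrite !mxE mulrC divfK. Qed.

(** Once [n] reaches [n0] no image is truncated, so [endo_mxP] applies to the images themselves. *)
Lemma endo_mx_idem n : (n0 <= n)%N -> endo_mx n *m endo_mx n = endo_mx n.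
Proof.
move=> n0n; apply/row_matrixP=> i; apply: (scalerI cF0); rewrite row_mul scalemxAl !row_endo.
by rewrite -endo_mxP ?eidem // (leq_trans (esize _)).
Qed.

(** The columns from [n] on vanish, so the larger matrix has blocks A, 0, B, 0. Idempotency gives B
    A = B, so the rows of B lie in the row space of A. *)
Lemma endo_mx_rank n n' : (n0 <= n)%N -> (n <= n')%N ->
  \rank (endo_mx n') = \rank (endo_mx n).
Proof.
move=> n0n nn'; rewrite -(subnKC nn'); move: (n' - n)%N => t.
have id' := endo_mx_idem (leq_trans n0n (leq_addr t n)).
set E := endo_mx (n + t) in id' *; set A := endo_mx n.
have eA : ulsubmx E = A by apply/matrixP=> i k; rewrite !mxE.
have col0 (i : 'I_(n + t)) (k : 'I_t) : E i (rshift n k) = 0.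
  rewrite mxE nth_default ?tofrac0 ?mul0r // (leq_trans (esize _)) // (leq_trans n0n) //=.
  exact: leq_addr.
have u0 : ursubmx E = 0 by apply/matrixP=> i k; rewrite !mxE -[RHS](col0 (lshift t i) k) mxE.
have d0 : drsubmx E = 0 by apply/matrixP=> i k; rewrite !mxE -[RHS](col0 (rshift n i) k) mxE.
move: id'; rewrite -[E]submxK eA u0 d0; set B := dlsubmx E.
rewrite mulmx_block !(mul0mx, mulmx0, addr0) => /eq_block_mx [_ _ BA _].
have -> : block_mx A 0 B 0 = row_mx (col_mx A B) (0 : 'M_(n + t, t)).
  by rewrite -[0 in RHS]col_mx0 -block_mxEh.
rewrite rank_row_mx0 -addsmxE; apply: eqmx_rank; apply/eqmxP.
by rewrite -BA; apply/addsmx_idPl; exact: submxMl.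
Qed.

End Endomorphism.

(** * Lattices preserved by these matrices at a maximal ideal *)

Section LocalHull.
Variables (R : idomainType) (m : R -> Prop) (mM : is_maximal_ideal m).
Local Notation F := {fraction R}.

Lemma local_hull_div r (X : 'rV[R]_r -> Prop) s v : ~ m s ->
  local_hull m X (s%:F *: v) -> local_hull m X v.
Proof.
move=> ms [t [x [mt Xx e]]]; exists (t * s), x; split=> //; first exact: nmemM.
by rewrite tofracM -scalerA.
Qed.

Lemma powL_local_hull_div r (X : 'rV[R]_r -> Prop) k s (v : 'rV[F]_(k * r)) : ~ m s ->
  powL (local_hull m X) (s%:F *: v) -> powL (local_hull m X) v.
Proof.
move=> ms; elim: k v => [|k IH] v //= [v1 v2]; rewrite linearZ /= in v1 *; rewrite linearZ /= in v2.
by split; [exact: local_hull_div v1 | exact: IH].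
Qed.

(** R_m^o times the k-th power of X_m; it is used with [o] = 0 at [m1] and [o] = 1 at [m2]. *)
Definition mixed_hull o r (X : 'rV[R]_r -> Prop) k : 'rV[F]_(o + k * r) -> Prop :=
  prodL (local_hull m (fun _ : 'rV[R]_o => True)) (powL (local_hull m X) (k := k)).

Variables (o r : nat) (X : 'rV[R]_r -> Prop) (sX : is_submod X) (r_gt0 : (0 < r)%N).
Variables (P : {poly R} -> Prop) (a : R).
Hypotheses (ma : ~ m a) (aP : forall p, (forall j, X (block o r j p)) -> P (a *: p)).
Hypothesis (PX : forall p j, P p -> X (block o r j p)).

Lemma mixed_hull_rowQ k p : P p -> mixed_hull X (rowQ (o + k * r) p).
Proof.
move=> Pp; split.
  exists 1, (\row_i p`_i); split=> //; first exact: nmem1.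
  by rewrite tofrac1 scale1r; apply/rowP=> i; rewrite !mxE.
have -> : rsubmx (rowQ (o + k * r) p) = \row_(i < k * r) (p`_(o + i))%:F.
  by apply/rowP=> i; rewrite !mxE.
apply/(powL_rowP (local_hull m X) k (fun i => (p`_(o + i))%:F)) => j _. 
exists 1, (block o r j p); split; [exact: nmem1 | exact: PX|].
by rewrite tofrac1 scale1r; apply/rowP=> i; rewrite !mxE.
Qed.

(** A common denominator of the finitely many blocks puts them into X, and the further factor [a],
    invertible at [m], puts the polynomial into [P]. *)
Lemma mixed_hull_clear k (v : 'rV[F]_(o + k * r)) : mixed_hull X v ->
  exists s p, [/\ ~ m s, P p, (size p <= o + k * r)%N & s%:F *: v = rowQ (o + k * r) p].
Proof.
set n := (o + k * r)%N => -[hd tl].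
(* Extending [v] by 0 lets its blocks be addressed by natural numbers. *)
pose f i : F := if insub i is Some i' then v 0 i' else 0.
have fE (i : 'I_n) : f i = v 0 i by rewrite /f valK.
have f0 i : (n <= i)%N -> f i = 0 by move=> ni; rewrite /f insubF // ltnNge ni.
have {tl} tl : powL (local_hull m X) (\row_(i < k * r) f (o + i)%N).
  suff <- : rsubmx v = \row_(i < k * r) f (o + i)%N by [].
  by apply/rowP=> i; rewrite !mxE -(fE (rshift o i)).
move/(powL_rowP (local_hull m X) k (fun i => f (o + i)%N)) : tl => tl.
have {hd} [s0 [y [ms0 _ ey]]] := hd.
have [s1 ms1 /choice [x xP]] : exists2 s, ~ m s & forall j : 'I_k,
    exists x, X x /\ s%:F *: (\row_(i < r) f (o + (j * r + i))%N) = tofracV x.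
  apply: (@common_multiplier R (fun s => ~ m s) _ (fun (j : 'I_k) s =>
    exists x, X x /\ s%:F *: (\row_(i < r) f (o + (j * r + i))%N) = tofracV x)).
  - exact: nmem1.
  - exact: nmemM.
  - move=> j b s [x [Xx e]]; exists (b *: x); split; first by case: sX => _ _; apply.
    by rewrite tofracVZ tofracM -scalerA e.
  - by move=> j; have [s [x [ms Xx e]]] := tl j (ltn_ord j); exists s => //; exists x.
pose s := s0 * s1.
have blk j : exists x', X x' /\ s%:F *: (\row_(i < r) f (o + (j * r + i))%N) = tofracV x'.
  case: (ltnP j k) => jk.
    have [Xx e] := xP (Ordinal jk); exists (s0 *: x (Ordinal jk)).
    split; first by case: sX => _ _; apply.
    by rewrite tofracVZ -e scalerA tofracM.
  exists 0; split; first by case: sX.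
  rewrite tofracV0; apply/rowP=> i; rewrite !mxE f0 ?mulr0 // /n; nia.
have /choice [g gP] : forall i, exists gi : R, gi%:F = s%:F * f i.
  move=> i; case: (ltnP i o) => io.
    exists (s1 * y 0 (Ordinal io)); have := congr1 (fun u : 'rV_o => u 0 (Ordinal io)) ey.
    rewrite !mxE -fE /= => e; rewrite /s !tofracM -e; ring.
  have [x' [_ e]] := blk ((i - o) %/ r)%N.
  have lt : ((i - o) %% r < r)%N by rewrite ltn_mod.
  exists (x' 0 (Ordinal lt)); have := congr1 (fun u : 'rV_r => u 0 (Ordinal lt)) e.
  by rewrite !mxE /= -divn_eq subnKC.
have g0 i : (n <= i)%N -> g i = 0.
  by move=> ni; apply/eqP; rewrite -tofrac_eq0 gP f0 ?mulr0.
pose p := \poly_(i < n) g i.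
have cp i : p`_i = g i by rewrite coef_poly; case: ltnP => // /g0.
exists (a * s), (a *: p); split.
- by apply: nmemM => //; exact: nmemM.
- apply: aP => j; have [x' [Xx' e]] := blk j.
  suff -> : block o r j p = x' by [].
  by apply: tofracV_inj; rewrite -e; apply/rowP=> i; rewrite !mxE cp gP.
- by rewrite (leq_trans (size_scale_leq _ _)) // size_poly.
- by apply/rowP=> i; rewrite !mxE coefZ cp tofracM [RHS]tofracM gP fE mulrA.
Qed.

Hypotheses (sP : is_submod P).
Variables (e : submod sP -> submod sP) (c : R) (n0 : nat).
Hypotheses (elin : is_linear_map e) (eidem : forall x, e (e x) = e x).
Hypotheses (c0 : c != 0) (cP : forall p, P (c *: p)).
Hypothesis (esize : forall x, (size (val (e x)) <= n0)%N).
Local Notation E n := (endo_mx e cP n).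

(** Denominators are cleared, [e] is applied inside the module, and the denominator, invertible at
    [m], is divided out again. *)
Lemma endo_mx_preserves k : preserves (mixed_hull X (k := k)) (E (o + k * r)).
Proof.
move=> v /mixed_hull_clear [s [p [ms Pp sp ev]]].
have : mixed_hull X (s%:F *: (v *m E (o + k * r))).
  rewrite scalemxAl ev -[p]/(val (mk_submod sP Pp)) -(endo_mxP elin c0 cP) //.
  apply: mixed_hull_rowQ; exact: submodP.
case; rewrite !linearZ /= => h1 h2; split; first exact: local_hull_div h1.
exact: powL_local_hull_div h2.
Qed.

(** The invertible corner accounts for rank [o]; its Schur complement is an idempotent preserving a
    power of X_m. *)
Lemma endo_mx_rank_mod k : local_stabilizer (local_hull m X) -> (n0 <= o + k * r)%N ->
  ulsubmx (E (o + k * r)) \in unitmx ->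
  preserves (local_hull m (fun _ : 'rV[R]_o => True)) (invmx (ulsubmx (E (o + k * r)))) ->
  exists q, \rank (E (o + k * r)) = (o + q * r)%N.
Proof.
move=> lX n0n uE pV.
have sH1 : subgroup (local_hull m (fun _ : 'rV[R]_o => True)) by apply: subgroup_local_hull.
have sH2 := subgroup_local_hull mM sX.
have := local_idempotent_rank sH2 lX
  (preserves_schur sH1 (subgroup_powL k sH2) (@endo_mx_preserves k) pV)
  (schur_idem uE (endo_mx_idem elin eidem c0 cP esize n0n)).
by rewrite (schur_rank uE) => /dvdnP [q ->]; exists q.
Qed.
End LocalHull.

(** * The glued module is not a direct sum of finitely generated modules *)

Section NotDirectSum.
Variables (R : idomainType) (m1 m2 : R -> Prop).
Hypotheses (m1M : is_maximal_ideal m1) (m2M : is_maximal_ideal m2).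
Local Notation F := {fraction R}.
Variables (r1 r2 : nat) (X1 : 'rV[R]_r1 -> Prop) (X2 : 'rV[R]_r2 -> Prop).
Hypotheses (sX1 : is_submod X1) (sX2 : is_submod X2).
Hypotheses (r1_gt0 : (0 < r1)%N) (r2_gt0 : (0 < r2)%N).
Hypotheses (lX1 : local_stabilizer (local_hull m1 X1)) (lX2 : local_stabilizer (local_hull m2 X2)).
Variables (a1 a2 : R).
Hypotheses (m2a1 : ~ m2 a1) (a1X : forall x, X1 (a1 *: x)).
Hypotheses (m1a2 : ~ m1 a2) (a2X : forall x, X2 (a2 *: x)).
Local Notation sN := (glued_submod sX1 sX2).

Lemma glued_not_dsum : ~~ coprime r1 r2 -> ~ dsum_of_fg (submod sN).
Proof.
move=> /negP ncop /dsum_projections [J [e [elin eidem efg edec]]]; apply: ncop.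
have [X10 X1D X1Z] := sX1; have [X20 X2D X2Z] := sX2.
(* The constant [a1] is in N: [a1] conducts into X1, and the blocks with offset 1 do not see
   coefficient 0. *)
have g1 : glued X1 X2 (a1%:P).
  split=> j.
    have -> : block 0 r1 j a1%:P = a1 *: block 0 r1 j 1.
      by rewrite -blockZ -mul_polyC mulr1.
    exact: a1X.
  suff -> : block 1 r2 j a1%:P = 0 by [].
  by apply/rowP=> i; rewrite !mxE coefC.
pose x1 : submod sN := mk_submod sN g1.
have [l el] := edec x1.
(* The components of [x1] sum to [a1], which is outside [m2], so some component has constant
   coefficient outside [m2]. *)
have [j mj] : exists j, ~ m2 (val (e j x1))`_0.
  apply: contrapT => none; apply: m2a1.
  have -> : a1 = (val x1)`_0 by rewrite /= coefC.
  have [[m20 m2D _] _ _] := m2M.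
  rewrite el submod_val_sum coef_sum; apply: big_ind => // j _.
  by apply: contrapT => mj; apply: none; exists j.
have {edec el} [eD eZ] := elin j.
have [n0 esize] : exists n0, forall x, (size (val (e j x)) <= n0)%N.
  have [n [g gP]] := efg j; exists (\max_i size (val (g i)))%N => x.
  have [c ->] := gP x; rewrite submod_val_sum (leq_trans (size_sum _ _ _)) //.
  apply/bigmax_leqP => i _; rewrite submod_valZ (leq_trans (size_scale_leq _ _)) //.
  exact: leq_bigmax.
(* [c] multiplies every polynomial into N. *)
pose c := a1 * a2.
have a10 : a1 != 0 by exact: maximal_neq0 m2M m2a1.
have c0 : c != 0 by rewrite mulf_neq0 // (maximal_neq0 m1M).
have cP p : glued X1 X2 (c *: p).
  split=> i; rewrite blockZ /c; first by rewrite -scalerA; exact: a1X.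
  by rewrite mulrC -scalerA; exact: a2X.
pose E n := endo_mx (e j) cP n.
set al := (val (e j x1))`_0 in mj.
have al0 : al%:F != 0 :> F by exact: tofrac_nmem m2M _ mj.
have a1F : a1%:F != 0 :> F by rewrite tofrac_eq0.
(* These make n0 <= k1 r1 <= 1 + k2 r2, so both matrices are large enough and have the same rank. *)
pose k1 := n0; pose k2 := (n0 * r1)%N.
(* At [m1] the corner is empty. *)
have [q1 e1] : exists q, \rank (E (0 + k1 * r1)%N) = (0 + q * r1)%N.
  apply: (@endo_mx_rank_mod R m1 m1M 0 r1 X1 sX1 r1_gt0 (glued X1 X2) a2 m1a2 _ _ sN _ _ n0) => //.
  - move=> p Xp; split=> i; rewrite blockZ; first exact: X1Z.
    exact: a2X.
  - by move=> p i [].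
  - by rewrite /k1; nia.
  - by rewrite unitmxE det_mx00 unitr1.
  - by move=> v _; exists 1, 0; split=> //; [exact: nmem1 | apply/rowP => -[]].
(* The first row comes from the constant [c] = a2 a1, whose image has constant coefficient a2 al;
   dividing by [c] leaves al / a1, a unit of R_m2. *)
have ulE k : ulsubmx (E (1 + k * r2)%N) = (al%:F / a1%:F)%:M.
  apply/matrixP=> i0 k0; rewrite !ord1 !mxE eqxx mulr1n /=.
  set w := mk_submod _ _.
  have ew : a1 *: w = c *: x1.
    by apply: val_inj; rewrite !submod_valZ /= expr0 alg_polyC -!mul_polyC mulrC.
  have := congr1 (fun y => ((val (e j y))`_0)%:F) ew.
  rewrite !eZ !submod_valZ !coefZ tofracM [RHS]tofracM => eq2.
  apply: (mulfI a1F); rewrite mulrA eq2 mulrC mulKf ?tofrac_eq0 //.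
  by rewrite mulrCA divff ?mulr1.
have [q2 e2] : exists q, \rank (E (1 + k2 * r2)%N) = (1 + q * r2)%N.
  apply: (@endo_mx_rank_mod R m2 m2M 1 r2 X2 sX2 r2_gt0 (glued X1 X2) a1 m2a1 _ _ sN _ _ n0) => //.
  - move=> p Xp; split=> i; rewrite blockZ; last exact: X2Z.
    exact: a1X.
  - by move=> p i [].
  - by rewrite /k2; nia.
  - by rewrite [ulsubmx _]ulE unitmxE det_scalar1 unitfE mulf_neq0 ?invr_eq0.
  - rewrite [ulsubmx _]ulE invmx_scalar => v [s [x [ms _ ev]]].
    exists (al * s), (a1 *: x); split=> //; first exact: nmemM.
    rewrite mul_mx_scalar tofracVZ -ev !scalerA tofracM; congr (_ *: _).
    by rewrite invf_div mulrCA [al%:F * _]mulrC mulfK.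
have rk : \rank (E (1 + k2 * r2)%N) = \rank (E (0 + k1 * r1)%N).
  by apply: (endo_mx_rank (elin j) (eidem j) c0 cP esize); rewrite /k1 /k2; nia.
have : (gcdn r1 r2 %| 1 + q2 * r2)%N.
  by rewrite -e2 rk e1 add0n dvdn_mull // dvdn_gcdl.
by rewrite dvdn_addl ?dvdn1 // dvdn_mull // dvdn_gcdr.
Qed.
End NotDirectSum.

(** * Realizing and gluing the two given modules *)

Lemma model_rank_gt0 (R : idomainType) (m : R -> Prop) (M : lmodType (Loc m)) r
    (X : 'rV[R]_r -> Prop) (phi : M -> 'rV[{fraction R}]_r) :
  is_model X phi -> indecomposable M -> (0 < r)%N.
Proof.
case: r X phi => // X phi [_ _ phiK _] [[x x0] _].
by move/eqP: x0; case; apply: phiK; apply/rowP=> -[].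
Qed.

Lemma conductor_ideal (R : idomainType) r (X : 'rV[R]_r -> Prop) :
  is_submod X -> is_ideal (fun a => forall x, X (a *: x)).
Proof.
move=> [X0 XD XZ]; split=> [x|a b Xa Xb x|a b Xb x].
- by rewrite scale0r.
- by rewrite scalerDl; apply: XD.
- by rewrite -scalerA; apply: XZ.
Qed.

Theorem mainTheorem6 (R : idomainType) (m1 m2 : R -> Prop)
  (M1 : lmodType (Loc m1)) (M2 : lmodType (Loc m2)) (r1 r2 : nat) :
  h_local R ->
  is_maximal_ideal m1 -> is_maximal_ideal m2 -> ~ same_ideal m1 m2 ->
  fin_gen M1 -> indecomposable M1 -> torsion_free M1 -> local_end M1 ->
  has_rank (@locval R m1) M1 r1 ->
  fin_gen M2 -> indecomposable M2 -> torsion_free M2 -> local_end M2 ->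
  has_rank (@locval R m2) M2 r2 ->
  exists X1 X2 : lmodType R,
    [/\ genus_cond M1 r1 X1, genus_cond M2 r2 X2 &
        (~~ coprime r1 r2 ->
           exists N : lmodType R, in_Add (X1 * X2)%type N /\ ~ dsum_of_fg N)].
Proof.
move=> hl m1M m2M neq12 fg1 ind1 tf1 le1 rk1 fg2 ind2 tf2 le2 rk2.
have [gs1 [c1 [phi1 mod1]]] := exists_model m1M hl fg1 tf1 rk1.
have [gs2 [c2 [phi2 mod2]]] := exists_model m2M hl fg2 tf2 rk2.
have neq21 : ~ same_ideal m2 m1 by move=> h; apply: neq12 => x; split=> /h.
have s1 := spanned_submod gs1; have s2 := spanned_submod gs2.
exists (submod (spanned_submod gs1)), (submod (spanned_submod gs2)); split.
- exact: model_genus mod1 ind1 c1.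
- exact: model_genus mod2 ind2 c2.
move=> ncop.
have [a1 [m2a1 a1X]] := c1 m2 m2M neq21.
have [a2 [m1a2 a2X]] := c2 m1 m1M neq12.
(* The conductors of R^(r1) into X1 and of R^(r2) into X2 are comaximal: a maximal ideal differs
   from [m1] or from [m2], and [c1] or [c2] then gives a conductor element outside it. *)
have [j1 [j2 [j1X j2X j12]]] : exists a b, [/\ forall x, spanned gs1 (a *: x)%R,
    forall x, spanned gs2 (b *: x)%R & (a + b = 1)%R].
  apply: (ideals_comax (conductor_ideal s1) (conductor_ideal s2)) => m mM.
  have [e1|/(c1 m mM) [u [mu uX]]] := pselect (same_ideal m m1); last by exists u; split=> //; left.
  have [|u [mu uX]] := c2 m mM; last by exists u; split=> //; right.
  by move=> e2; apply: neq12 => x; split=> [/e1/e2|/e2/e1].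
exists (submod (glued_submod (spanned_submod gs1) (spanned_submod gs2))).
have r1_gt0 := model_rank_gt0 mod1 ind1; have r2_gt0 := model_rank_gt0 mod2 ind2.
split; first exact: (glued_in_Add _ _ r1_gt0 r2_gt0 j1X j2X j12).
have a10 := maximal_neq0 m2M m2a1; have a20 := maximal_neq0 m1M m1a2.
apply: (@glued_not_dsum R m1 m2 m1M m2M r1 r2 _ _ _ _ r1_gt0 r2_gt0 _ _ a1 a2 m2a1 a1X m1a2 a2X ncop).
  exact: (model_local_stabilizer m1M mod1 a10 a1X le1).
exact: (model_local_stabilizer m2M mod2 a20 a2X le2).
Qed.
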